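(* Let each $f_i:\mathbb{R}^d\to\mathbb{R}$ ($i\in[n]$) be convex and $L_i$-smooth with $L_i>0$, let $f=\frac1n\sum_{i=1}^nf_i$ have a minimizer $\mathbf{x}_*\in\mathbb{R}^d$, and let $\sigma_*^2=\frac1n\sum_{i=1}^n\|\nabla f_i(\mathbf{x}_* )\|_2^2$ (assumed finite). Run shuffled SGD (Algorithm 2, described in the context) for $K\ge1$ epochs with batch size $b$, with uniformly random shuffling (either the SO or the RR scheme), and with deterministic step sizes $\eta_1,\dots,\eta_K>0$ such that, for each $k\in[K]$, $$\eta_k\le\frac{b}{n\sqrt{2\hat L^g_{\pi^{(k)}}\tilde L^g_{\pi^{(k)}}}}$$ (for every realization of $\pi^{(k)}$). Let $H_K=\sum_{k=1}^K\eta_k$. Then the output $\hat{\mathbf{x}}_K$ satisfies $$\mathbb{E}\big[H_K\big(f(\hat{\mathbf{x}}_K)-f(\mathbf{x}_* )\big)\big]\le\frac{b}{2n}\|\mathbf{x}_0-\mathbf{x}_*\|_2^2+\sum_{k=1}^K\frac{\eta_k^3\tilde L^g(n-b)(n+b)}{6b^2(n-1)}\sigma_*^2 .$$ Consequently, for any $\epsilon>0$, there exists a constant step size $\eta_k=\eta$ for which $\mathbb{E}[f(\hat{\mathbf{x}}_K)-f(\mathbf{x}_* )]\le\epsilon$ after $$\mathcal{O}\Big(\frac{n\sqrt{\hat L^g\tilde L^g}\,\|\mathbf{x}_0-\mathbf{x}_*\|_2^2}{\epsilon}+\sqrt{\frac{(n-b)(n+b)}{n(n-1)}}\;\frac{\sqrt{n\tilde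 L^g}\,\sigma_*\|\mathbf{x}_0-\mathbf{x}_*\|_2^2}{\epsilon^{3/2}}\Big)$$ individual gradient queries; that is, there is an absolute constant $C>0$ such that for every $\epsilon>0$ and every integer $K\ge1$ with $nK$ at least $C$ times the expression inside $\mathcal{O}(\cdot)$, some constant step size $\eta>0$ gives $\mathbb{E}[f(\hat{\mathbf{x}}_K)-f(\mathbf{x}_* )]\le\epsilon$.
   Context: Setting: $n\ge2$, $d,b,m\ge1$ are integers with $n=bm$; $[n]=\{1,\dots,n\}$. A differentiable $f_i$ is $L_i$-smooth if $\|\nabla f_i(\mathbf{x})-\nabla f_i(\mathbf{y})\|_2\le L_i\|\mathbf{x}-\mathbf{y}\|_2$ for all $\mathbf{x},\mathbf{y}\in\mathbb{R}^d$. $f_i^*$ denotes the convex conjugate of $f_i$. $\|\cdot\|_2$ is the Euclidean norm for vectors and the operator norm for matrices. $\mathbf{E}\in\mathbb{R}^{nd\times d}$ is the vertical concatenation of $n$ copies of the identity $\mathbf{I}_d$, and $\mathbf{E}_b\in\mathbb{R}^{bd\times d}$ the vertical concatenation of $b$ copies of $\mathbf{I}_d$. For a permutation $\pi$ of $[n]$, $\boldsymbol\Lambda_\pi\in\mathbb{R}^{nd\times nd}$ is the diagonal matrix with diagonal $L_{\pi_1}$ repeated $d$ times, then $L_{\pi_2}$ repeated $d$ times, ..., then $L_{\pi_n}$ repeated $d$ times. $\mathbf{I}_{j\uparrow}$ is the $nd\times nd$ identity matrix with its first $j$ diagonal entries set to zero; $\mathbf{I}_{(di)}$ is the $nd\times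 nd$ diagonal matrix with diagonal entries $1$ in positions $bd(i-1)+1,\dots,bdi$ and $0$ elsewhere. Define $$\hat L^g_\pi=\frac1{mn}\Big\|\boldsymbol\Lambda_\pi^{1/2}\Big(\sum_{i=1}^m\mathbf{I}_{bd(i-1)\uparrow}\mathbf{E}\mathbf{E}^\top\mathbf{I}_{bd(i-1)\uparrow}\Big)\boldsymbol\Lambda_\pi^{1/2}\Big\|_2,\qquad\tilde L^g_\pi=\frac1b\Big\|\boldsymbol\Lambda_\pi^{1/2}\Big(\sum_{i=1}^m\mathbf{I}_{(di)}\mathbf{E}\mathbf{E}^\top\mathbf{I}_{(di)}\Big)\boldsymbol\Lambda_\pi^{1/2}\Big\|_2,$$ $\hat L^g=\max_\pi\hat L^g_\pi$, $\tilde L^g=\max_\pi\tilde L^g_\pi$ (maxima over all permutations of $[n]$). Algorithm 2 (shuffled SGD, primal-dual view). Input: $\mathbf{x}_0\in\mathbb{R}^d$, batch size $b$, step sizes $\eta_k>0$, number of epochs $K$. For $k=1,\dots,K$: choose a permutation $\pi^{(k)}$ of $[n]$; set $\mathbf{x}_{k-1,1}=\mathbf{x}_{k-1}$; for $i=1,\dots,m$ set $\mathbf{y}_k^{(i)}=\operatorname{argmax}\{\langle\mathbf{E}_b^\top\mathbf{y}^{(i)},\mathbf{x}_{k-1,i}\rangle-\sum_{j=1}^bf^*_{\pi^{(k)}_{b(i-1)+j}}(\mathbf{y}^j)\}$ over $\mathbf{y}^{(i)}=(\mathbf{y}^1,\dots,\mathbf{y}^b)\in\mathbb{R}^{bd}$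 with $\mathbf{y}^j\in\mathbb{R}^d$, and $\mathbf{x}_{k-1,i+1}=\operatorname{argmin}_{\mathbf{x}\in\mathbb{R}^d}\{\langle\mathbf{E}_b^\top\mathbf{y}_k^{(i)},\mathbf{x}\rangle+\frac{b}{2\eta_k}\|\mathbf{x}-\mathbf{x}_{k-1,i}\|_2^2\}$; then set $\mathbf{x}_k=\mathbf{x}_{k-1,m+1}$. Equivalently, $\mathbf{x}_{k-1,i+1}=\mathbf{x}_{k-1,i}-\frac{\eta_k}{b}\sum_{j=b(i-1)+1}^{bi}\nabla f_{\pi_j^{(k)}}(\mathbf{x}_{k-1,i})$. Output: $\hat{\mathbf{x}}_K=\sum_{k=1}^K\eta_k\mathbf{x}_k/\sum_{k=1}^K\eta_k$. Each epoch uses $n$ individual gradient queries. Shuffling schemes: RR (random reshuffling): $\pi^{(1)},\dots,\pi^{(K)}$ are independent uniformly random permutations of $[n]$. SO (shuffle once): $\pi^{(k)}=\pi$ for all $k$, with a single uniformly random permutation $\pi$. Expectations are over this randomness; $\mathbf{x}_0$ is deterministic. *)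

(* Defs.v *)
From HB Require Import structures.
From mathcomp Require Import all_boot all_order all_algebra all_fingroup.
From mathcomp Require Import all_classical all_reals all_analysis.

Set Implicit Arguments.
Unset Strict Implicit.
Unset Printing Implicit Defensive.

Import Order.TTheory GRing.Theory Num.Theory.
Import numFieldNormedType.Exports.

Local Open Scope classical_set_scope.
Local Open Scope ring_scope.

Definition dot (R : realType) (p : nat) (u v : 'cV[R]_p) : R :=
  \sum_(i < p) u i 0 * v i 0.

(* The canonical norm `|v| of 'cV[R]_p in the library is the sup norm. *)
Definition norm2 (R : realType) (p : nat) (v : 'cV[R]_p) : R :=
  Num.sqrt (dot v v).

Definition opnorm2 (R : realType) (p q : nat) (A : 'M[R]_(p, q)) : R :=
  sup [set norm2 (A *m v) | v in [set v : 'cV[R]_q | norm2 v <= 1]].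

Definition grad (R : realType) (d : nat) (f : 'cV[R]_d -> R) (x : 'cV[R]_d) :
    'cV[R]_d :=
  \col_(j < d) 'D_(delta_mx j 0) (f : 'cV[R]_d -> R^o) x.

Definition smooth (R : realType) (d : nat) (L : R) (f : 'cV[R]_d -> R) : Prop :=
  (forall x, differentiable (f : 'cV[R]_d -> R^o) x) /\
  (forall x y, norm2 (grad f x - grad f y) <= L * norm2 (x - y)).

Definition conjugate (R : realType) (d : nat) (f : 'cV[R]_d -> R)
    (y : 'cV[R]_d) : \bar R :=
  ereal_sup [set (dot y x - f x)%:E | x in [set: 'cV[R]_d]].

(* An arbitrary maximizer (minimizer) of F if there is one; in the algorithm
   below both exist and are unique when the f i are convex and smooth. *)
Definition argmax (T : pointedType) (disp : Order.disp_t)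
    (V : porderType disp) (F : T -> V) : T :=
  get [set y : T | forall z, (F z <= F y)%O].

Definition argmin (T : pointedType) (disp : Order.disp_t)
    (V : porderType disp) (F : T -> V) : T :=
  get [set y : T | forall z, (F y <= F z)%O].

(* Block vectors and matrices made of q blocks of size d live in dimension
   \sum_(i < q) d, which is the number q * d in the form used by the library's
   block matrices. *)
Definition stackI (R : realType) (q d : nat) : 'M[R]_(\sum_(i < q) d, d) :=
  \mxcol_(i < q) (1%:M : 'M[R]_d).

Definition Lam (R : realType) (n d : nat) (L : 'I_n -> R) (pi : 'S_n) :
    'M[R]_(\sum_(i < n) d) :=
  \mxdiag_(i < n) ((L (pi i))%:M : 'M[R]_d).

(* Lam is diagonal with nonnegative entries (and Num.sqrt 0 = 0), so the
   entrywise square root is its square root as a matrix. *)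
Definition Lam_sqrt (R : realType) (n d : nat) (L : 'I_n -> R) (pi : 'S_n) :
    'M[R]_(\sum_(i < n) d) :=
  map_mx Num.sqrt (Lam d L pi).

Definition Iup (R : realType) (N j : nat) : 'M[R]_N :=
  diag_mx (\row_(p < N) (j <= p)%N%:R).

(* Batches are numbered from 0 here: i stands for the usual i + 1. *)
Definition Ibatch (R : realType) (N b d i : nat) : 'M[R]_N :=
  diag_mx (\row_(p < N) (b * d * i <= p < b * d * i.+1)%N%:R).

Definition Lhat_pi (R : realType) (n d b m : nat) (L : 'I_n -> R) (pi : 'S_n) :
    R :=
  let E := stackI R n d in
  (m%:R * n%:R)^-1 *
  opnorm2 (Lam_sqrt d L pi *m
           (\sum_(i < m) Iup R _ (b * d * i) *m E *m E^T
                         *m Iup R _ (b * d * i)) *m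
           Lam_sqrt d L pi).

Definition Ltilde_pi (R : realType) (n d b m : nat) (L : 'I_n -> R)
    (pi : 'S_n) : R :=
  let E := stackI R n d in
  b%:R^-1 *
  opnorm2 (Lam_sqrt d L pi *m
           (\sum_(i < m) Ibatch R _ b d i *m E *m E^T *m Ibatch R _ b d i) *m
           Lam_sqrt d L pi).

(* The default value 0 of the maxima is harmless: all terms are >= 0. *)
Definition Lhat (R : realType) (n d b m : nat) (L : 'I_n -> R) : R :=
  \big[Num.max/0]_(pi : 'S_n) Lhat_pi d b m L pi.

Definition Ltilde (R : realType) (n d b m : nat) (L : 'I_n -> R) : R :=
  \big[Num.max/0]_(pi : 'S_n) Ltilde_pi d b m L pi.

Lemma batch_index_subproof (n b m : nat) (hn : n = (b * m)%N) (i : 'I_m)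
  (j : 'I_b) : (b * i + j < n)%N.
Proof.
rewrite hn; apply: (@leq_trans (b * i.+1)); last by rewrite leq_mul2l ltn_ord orbT.
by rewrite mulnS addnC ltn_add2r.
Qed.

Definition batch_index (n b m : nat) (hn : n = (b * m)%N) (i : 'I_m)
    (j : 'I_b) : 'I_n :=
  Ordinal (batch_index_subproof hn i j).

Section Algorithm.
Variables (R : realType) (n d b m : nat) (hn : n = (b * m)%N).
Variable f : 'I_n -> 'cV[R]_d -> R.

Definition dual_step (pi : 'S_n) (i : 'I_m) (x : 'cV[R]_d) :
    'cV[R]_(\sum_(j < b) d) :=
  argmax (fun y : 'cV[R]_(\sum_(j < b) d) =>
    ((dot ((stackI R b d)^T *m y) x)%:E
     - \sum_(j < b) conjugate (f (pi (batch_index hn i j))) (submxcol y j))%E).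

Definition primal_step (eta : R) (y : 'cV[R]_(\sum_(j < b) d))
    (x : 'cV[R]_d) : 'cV[R]_d :=
  argmin (fun z : 'cV[R]_d =>
    dot ((stackI R b d)^T *m y) z + b%:R / (2 * eta) * norm2 (z - x) ^+ 2).

Definition epoch (pi : 'S_n) (eta : R) (x : 'cV[R]_d) : 'cV[R]_d :=
  foldl (fun x i => primal_step eta (dual_step pi i x) x) x (enum 'I_m).

(* eta k and pi k are used for k = 1, ..., K only. *)
Fixpoint iterate (eta : nat -> R) (pi : nat -> 'S_n) (x0 : 'cV[R]_d)
    (k : nat) : 'cV[R]_d :=
  if k is k'.+1 then epoch (pi k) (eta k) (iterate eta pi x0 k') else x0.

Definition output (eta : nat -> R) (x0 : 'cV[R]_d) (K : nat)
    (pi : nat -> 'S_n) : 'cV[R]_d :=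
  (\sum_(1 <= k < K.+1) eta k)^-1 *:
  \sum_(1 <= k < K.+1) eta k *: iterate eta pi x0 k.

End Algorithm.

Inductive scheme := RR | SO.

Definition unif_mean (R : realType) (T : finType) (g : T -> R) : R :=
  #|T|%:R^-1 * \sum_(t : T) g t.

(* Expectation of g over the random permutations pi 1, ..., pi K, where K
   independent uniform permutations amount to one uniform K-tuple; the values
   of pi at indices outside 1, ..., K are irrelevant. *)
Definition expect (R : realType) (n : nat) (sch : scheme) (K : nat)
    (g : (nat -> 'S_n) -> R) : R :=
  match sch with
  | RR => unif_mean (fun s : K.-tuple 'S_n => g (fun k => nth 1%g s k.-1))
  | SO => unif_mean (fun p : 'S_n => g (fun=> p))
  end.

Definition favg (R : realType) (n d : nat) (f : 'I_n -> 'cV[R]_d -> R)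
    (x : 'cV[R]_d) : R :=
  n%:R^-1 * \sum_(i < n) f i x.

Definition sigma2 (R : realType) (n d : nat) (f : 'I_n -> 'cV[R]_d -> R)
    (xs : 'cV[R]_d) : R :=
  n%:R^-1 * \sum_(i < n) norm2 (grad (f i) xs) ^+ 2.

(* Main.v *)
Require Import Defs.
From mathcomp Require Import all_boot all_order all_algebra all_fingroup.
From mathcomp Require Import all_classical all_reals all_analysis.
From mathcomp Require Import ring lra.
Import Order.TTheory GRing.Theory Num.Theory.
Import numFieldNormedType.Exports.
Local Open Scope classical_set_scope.
Local Open Scope ring_scope.

(** The steps of the algorithm are gradient steps: by the Fenchel-Young inequality
    the dual maximizer consists of the gradients of the batch at the current
    point ([argmax_conjugate]), and the primal step moves against their sum
    ([primal_stepE]).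

    The analysis of one epoch ([epoch_descent]) compares each component function at
    three points: where its gradient is evaluated, at the end of the epoch, and at
    the minimizer. Convexity and smoothness provide, besides the linear terms, two
    negative squares of gradient differences, weighted by the inverse smoothness
    constants. The linear terms telescope to a difference of squared distances to
    the minimizer, up to cross terms between the gradient differences of a batch and
    the sum of all gradients used from that batch on. Up to scaling, the two operator norms are
    the best constants in the inequalities that bound batch sums and tail sums by
    such weighted squares ([batch_sums_le], [tail_sums_le]), so Young's inequality
    and the step size condition let the negative squares absorb everything
    except the tail sums of the gradients at the minimizer.

    These tail sums depend only on the permutation of the epoch. The gradients at
    the minimizer have sum zero, so the expected square of a tail sum is the variance
    of sampling without replacement ([sampling_without_replacement]), and summing
    over the batches gives the factor [(n - b) (n + b) / (n - 1)]. As each epoch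
    contributes separately, only the uniform law of each single permutation enters,
    which both shuffling schemes share ([expect_unif_mean]). Summing
    over epochs and applying Jensen's inequality gives the bound on the gap
    ([expected_gap]); balancing its two terms by the choice of a constant step
    size gives the complexity ([complexity]), with the constant 2. *)

Set Implicit Arguments.
Unset Strict Implicit.
Unset Printing Implicit Defensive.

(** * Euclidean geometry and smooth convex functions *)

Section Euclidean.
Context {R : realType}.

Section Dot.
Context {p : nat}.
Implicit Types (u v w : 'cV[R]_p) (a b : R).

Lemma dotE u v : dot u v = (u^T *m v) 0 0.
Proof. by rewrite mxE; apply: eq_bigr => i _; rewrite mxE. Qed.

Lemma dotC u v : dot u v = dot v u.
Proof. by apply: eq_bigr => i _; rewrite mulrC. Qed.

Lemma dotDl u v w : dot (u + v) w = dot u w + dot v w.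
Proof. by rewrite -big_split; apply: eq_bigr => i _; rewrite mxE mulrDl. Qed.

Lemma dotZl a u v : dot (a *: u) v = a * dot u v.
Proof. by rewrite big_distrr; apply: eq_bigr => i _; rewrite mxE /= mulrA. Qed.

Lemma dotNl u v : dot (- u) v = - dot u v.
Proof. by rewrite -scaleN1r dotZl mulN1r. Qed.

Lemma dotBl u v w : dot (u - v) w = dot u w - dot v w.
Proof. by rewrite dotDl dotNl. Qed.

Lemma dotDr u v w : dot w (u + v) = dot w u + dot w v.
Proof. by rewrite dotC dotDl !(dotC w). Qed.

Lemma dotZr a u v : dot u (a *: v) = a * dot u v.
Proof. by rewrite dotC dotZl dotC. Qed.

Lemma dotNr u v : dot u (- v) = - dot u v.
Proof. by rewrite dotC dotNl dotC. Qed.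

Lemma dotBr u v w : dot w (u - v) = dot w u - dot w v.
Proof. by rewrite dotDr dotNr. Qed.

Lemma dotBC u v : dot (u - v) (u - v) = dot (v - u) (v - u).
Proof. by rewrite -opprB dotNl dotNr opprK. Qed.

Lemma dot0l u : dot 0 u = 0.
Proof. by rewrite -(scale0r u) dotZl mul0r. Qed.

Lemma dot0r u : dot u 0 = 0.
Proof. by rewrite dotC dot0l. Qed.

Lemma dot_suml (I : Type) (r : seq I) (P : pred I) (F : I -> 'cV[R]_p) u :
  dot (\sum_(i <- r | P i) F i) u = \sum_(i <- r | P i) dot (F i) u.
Proof.
by elim/big_rec2: _ => [|i x y _ <-]; rewrite ?dot0l ?dotDl.
Qed.

Lemma dot_sumr (I : Type) (r : seq I) (P : pred I) (F : I -> 'cV[R]_p) u :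
  dot u (\sum_(i <- r | P i) F i) = \sum_(i <- r | P i) dot u (F i).
Proof. by rewrite dotC dot_suml; apply: eq_bigr => i _; rewrite dotC. Qed.

Lemma dot_ge0 u : 0 <= dot u u.
Proof. by apply: sumr_ge0 => i _; rewrite -expr2 sqr_ge0. Qed.

Lemma dot_eq0 u : dot u u = 0 -> u = 0.
Proof.
move=> /eqP; rewrite psumr_eq0 => [/allP h|i _]; last by rewrite -expr2 sqr_ge0.
apply/colP => i; have := h i (mem_index_enum _).
by rewrite -expr2 sqrf_eq0 mxE => /eqP.
Qed.

Lemma norm2_sqr u : norm2 u ^+ 2 = dot u u.
Proof. by rewrite sqr_sqrtr // dot_ge0. Qed.

Lemma norm2_ge0 u : 0 <= norm2 u.
Proof. exact: sqrtr_ge0. Qed.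

Lemma norm2_0 : norm2 (0 : 'cV[R]_p) = 0.
Proof. by rewrite /norm2 dot0l sqrtr0. Qed.

Lemma norm2Z a u : norm2 (a *: u) = `|a| * norm2 u.
Proof. by rewrite /norm2 dotZl dotZr mulrA -expr2 sqrtrM ?sqr_ge0 // sqrtr_sqr. Qed.

Lemma norm2_eq0 u : norm2 u = 0 -> u = 0.
Proof. by move=> u0; apply: dot_eq0; rewrite -norm2_sqr u0 expr0n. Qed.

Lemma norm2_delta (i : 'I_p) : norm2 (delta_mx i 0 : 'cV[R]_p) = 1.
Proof.
rewrite /norm2 /dot (bigD1 i) //= big1 ?addr0 => [|j /negbTE ji].
  by rewrite !mxE !eqxx mulr1 sqrtr1.
by rewrite !mxE ji mul0r.
Qed.

Lemma cauchy_schwarz u v : dot u v <= norm2 u * norm2 v.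
Proof.
have [u0|u0] := eqVneq (norm2 u) 0.
  by rewrite u0 (norm2_eq0 u0) dot0l mul0r.
have [v0|v0] := eqVneq (norm2 v) 0.
  by rewrite v0 (norm2_eq0 v0) dot0r mulr0.
have gu : 0 < norm2 u by rewrite lt_def u0 norm2_ge0.
have gv : 0 < norm2 v by rewrite lt_def v0 norm2_ge0.
have := dot_ge0 (norm2 v *: u - norm2 u *: v).
rewrite !(dotBl, dotBr, dotZl, dotZr) -!norm2_sqr (dotC v u).
rewrite [X in 0 <= X](_ : _ = 2 * (norm2 u * norm2 v)
  * (norm2 u * norm2 v - dot u v)); last by ring.
by rewrite pmulr_rge0 ?subr_ge0 // !mulr_gt0.
Qed.

(** Young's inequality, from the square of [a u + v]; the sign fits the cross
    terms of an epoch, where the displacement is minus a sum of gradients. *)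
Lemma dot_young a u v : 0 < a ->
  - dot u v <= a / 2 * dot u u + dot v v / (2 * a).
Proof.
move=> a0; have a2 : 0 < 2 * a by rewrite mulr_gt0.
have := dot_ge0 (a *: u + v).
rewrite !(dotDl, dotDr, dotZl, dotZr) (dotC v u) => h.
rewrite -subr_ge0 -(pmulr_rge0 _ a2).
apply: le_trans h _; rewrite le_eqVlt; apply/orP; left; apply/eqP.
by field; rewrite gt_eqF.
Qed.

Lemma dot_sqrD u v : dot (u + v) (u + v) <= 2 * dot u u + 2 * dot v v.
Proof.
have := dot_ge0 (u - v).
rewrite !(dotDl, dotDr, dotNl, dotNr) (dotC v u); lra.
Qed.

End Dot.

Lemma dot_mulmx p q (A : 'M[R]_(p, q)) u v :
  dot (A *m u) v = dot u (A^T *m v).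
Proof.
by rewrite !dotE trmx_mul mulmxA.
Qed.

End Euclidean.

Section ConvexSmooth.
Context {R : realType} {d : nat}.
Implicit Types (f : 'cV[R]_d -> R) (x y v : 'cV[R]_d) (c L : R).

(** Coordinates suffice to define the gradient because the differential is linear. *)
Lemma derive_grad f x v : differentiable (f : 'cV[R]_d -> R^o) x ->
  'D_v (f : 'cV[R]_d -> R^o) x = dot (grad f x) v.
Proof.
move=> df; rewrite deriveE //.
have {1}-> : v = \sum_(j < d) v j 0 *: delta_mx j 0.
  rewrite {1}[v]matrix_sum_delta; apply: eq_bigr => j _.
  by rewrite big_ord1.
rewrite linear_sum; apply: eq_bigr => j _.
by rewrite linearZ /= mxE deriveE // mulrC.
Qed.

(** A directional derivative is the limit of difference quotients from the right,
    so one-sided bounds on short segments control it. *)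
Lemma grad_le_slope f x v c : differentiable (f : 'cV[R]_d -> R^o) x ->
  (forall t, 0 < t < 1 -> f (x + t *: v) - f x <= t * c) ->
  dot (grad f x) v <= c.
Proof.
move=> df h; rewrite -derive_grad //.
have cv : h^-1 *: (f (h *: v + x) - f x) @[h --> 0^'] -->
    'D_v (f : 'cV[R]_d -> R^o) x by exact: diff_derivable.
have cr := cvg_dnbhs_at_right cv.
rewrite -(cvg_lim _ cr) //; apply: limr_le; first exact: cvgP cr.
near=> t.
have t0 : 0 < t by near: t; exact: nbhs_right_gt.
rewrite /= /GRing.scale /= mulrC ler_pdivrMr // mulrC (addrC _ x) h // t0.
by near: t; exact: nbhs_right_lt.
Unshelve. all: by end_near. Qed.

Lemma grad_ge_slope f x v c : differentiable (f : 'cV[R]_d -> R^o) x ->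
  (forall t, 0 < t < 1 -> t * c <= f (x + t *: v) - f x) ->
  c <= dot (grad f x) v.
Proof.
move=> df h; rewrite -derive_grad //.
have cv : h^-1 *: (f (h *: v + x) - f x) @[h --> 0^'] -->
    'D_v (f : 'cV[R]_d -> R^o) x by exact: diff_derivable.
have cr := cvg_dnbhs_at_right cv.
rewrite -(cvg_lim _ cr) //; apply: limr_ge; first exact: cvgP cr.
near=> t.
have t0 : 0 < t by near: t; exact: nbhs_right_gt.
rewrite /= /GRing.scale /= mulrC ler_pdivlMr // mulrC (addrC _ x) h // t0.
by near: t; exact: nbhs_right_lt.
Unshelve. all: by end_near. Qed.

Lemma vector_of_dot_ge u w : (forall v, dot u v <= dot w v) -> u = w.
Proof.
move=> h; apply/eqP; rewrite -subr_eq0; apply/eqP/dot_eq0/le_anti.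
by rewrite dot_ge0 andbT dotBl subr_le0 h.
Qed.

(** A subgradient bounds every directional derivative from below, also in the
    opposite direction, so differentiability leaves room for only one. *)
Lemma grad_subgradient_unique f x y : differentiable (f : 'cV[R]_d -> R^o) x ->
  (forall z, f x + dot y (z - x) <= f z) -> y = grad f x.
Proof.
move=> df h; apply: vector_of_dot_ge => v; apply: grad_ge_slope => // t _.
by have := h (x + t *: v); rewrite (addrC x) addrK dotZr lerBrDl.
Qed.

Lemma convex_segment f x y t : convex_function [set: 'cV[R]_d] f ->
  0 <= t <= 1 -> f (x + t *: (y - x)) <= f x + t * (f y - f x).
Proof.
move=> cf /andP[t0 t1].
have := cf (Itv01 t0 t1) y x (mem_set I) (mem_set I).
rewrite convRE /= /conv /= /unstable.onem.
rewrite (_ : t *: y + (1 - t) *: x = x + t *: (y - x)).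
  by move=> h; apply: le_trans h _; rewrite le_eqVlt; apply/orP; left; apply/eqP; ring.
by rewrite scalerBl scalerBr scale1r addrC -addrA (addrC (- _)).
Qed.


Lemma convex_grad_le f x y : convex_function [set: 'cV[R]_d] f ->
  differentiable (f : 'cV[R]_d -> R^o) x ->
  f x + dot (grad f x) (y - x) <= f y.
Proof.
move=> cf df; rewrite -lerBrDl; apply: grad_le_slope => // t /andP[t0 t1].
by rewrite lerBlDl convex_segment // !ltW.
Qed.

(** The difference of the two sides along the segment from [x] to [y], as a
    function of time, has derivative at most 0 by the Cauchy-Schwarz inequality and
    the Lipschitz bound on the gradient. *)
Lemma smooth_descent f L x y : smooth L f ->
  f y <= f x + dot (grad f x) (y - x) + L / 2 * norm2 (y - x) ^+ 2.
Proof.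
move=> [df lf]; set v := y - x.
pose phi t : R := f (x + t *: v) - t * dot (grad f x) v
                    - L / 2 * t ^+ 2 * norm2 v ^+ 2.
have line (t : R) : is_derive t 1 (fun t => f (x + t *: v) : R^o)
    (dot (grad f (x + t *: v)) v).
  (* Both derivatives are limits of the same difference quotient. *)
  have dE : (fun h => h^-1 *: (((fun t => f (x + t *: v) : R^o) \o shift t)
                     (h *: 1) - f (x + t *: v) : R^o)) =
            (fun h => h^-1 *: (((f : _ -> R^o) \o shift (x + t *: v)) (h *: v)
                     - f (x + t *: v))).
    apply/funext => h /=; congr (_ *: (f _ - _)).
    by rewrite [h *: 1]mulr1 scalerDl addrC -addrA (addrC (t *: v)).
  have := @diff_derivable _ _ _ (f : _ -> R^o) _ v (df (x + t *: v)).
  have := derive_grad v (df (x + t *: v)).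
  rewrite /derivable /derive -dE => gE cv.
  by split => //; rewrite -gE.
have dphi (t : R) : is_derive t 1 (phi : R -> R^o)
   (dot (grad f (x + t *: v)) v - dot (grad f x) v - L * t * norm2 v ^+ 2).
  rewrite (_ : phi = (fun t => f (x + t *: v) : R^o) - dot (grad f x) v \*: id
      - (L / 2 * norm2 v ^+ 2) \*: (id ^+ 2)); last first.
    by apply/funext => s; rewrite /phi !fctE /= /GRing.scale /=; ring.
  by apply: is_derive_eq; rewrite /GRing.scale /=; field.
have phic : {within `[0, 1], continuous phi}.
  by apply: derivable_within_continuous => s _; exact: ex_derive.
have : phi 1 <= phi 0.
  apply: (ler0_derive1_nincr (a := 0) (b := 1)) => //.
  move=> s; rewrite in_itv /= => /andP[s0 s1].
  rewrite derive1E derive_val -dotBl.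
  rewrite subr_le0; apply: le_trans (cauchy_schwarz _ _) _.
  apply: le_trans (ler_wpM2r (norm2_ge0 _) (lf _ _)) _.
  by rewrite (addrC x) addrK norm2Z ger0_norm ?(ltW s0) // expr2 !mulrA.
rewrite /phi scale1r scale0r addr0 /v addrCA subrr addr0.
rewrite expr1n expr0n /=; lra.
Qed.

(** Compare the tangent at [x] with the quadratic upper bound at [y], both at the
    point reached from [y] by a gradient step of length [1 / L] on the function
    minus its tangent at [x]. This strengthening of convexity is the strong
    convexity of the conjugate, stated without the conjugate. *)
Lemma convex_smooth_lower f L x y : 0 < L ->
  convex_function [set: 'cV[R]_d] f -> smooth L f ->
  f x + dot (grad f x) (y - x)
    + (2 * L)^-1 * dot (grad f y - grad f x) (grad f y - grad f x) <= f y.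
Proof.
move=> L0 cf sf; set g := grad f y - grad f x.
have low := convex_grad_le (y - L^-1 *: g) cf (sf.1 x).
have up := smooth_descent y (y - L^-1 *: g) sf.
have gE : dot (grad f y) g - dot (grad f x) g = dot g g by rewrite -dotBl.
clearbody g.
have := le_trans low up.
rewrite (_ : y - L^-1 *: g - y = - (L^-1 *: g)); last by rewrite addrC addKr.
rewrite norm2_sqr !(dotDr, dotNr, dotZr, dotZl, dotNl).
have -> : dot (grad f y) g = dot g g + dot (grad f x) g by rewrite -gE subrK.
rewrite -subr_ge0 => h; rewrite -subr_ge0.
apply: le_trans h _; rewrite le_eqVlt; apply/orP; left; apply/eqP.
by field; rewrite gt_eqF.
Qed.

(** In an epoch, [z] is the point where the gradient is evaluated, [x] the end of
    the epoch and [w] the minimizer. Two applications of the lower bound, at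
    [x] and at [z], leave two negative quadratic terms, which pay for the use of
    outdated gradients. *)
Lemma convex_smooth_three_point f L x z w : 0 < L ->
  convex_function [set: 'cV[R]_d] f -> smooth L f ->
  f x - f w <= dot (grad f x - grad f z) (x - z) + dot (grad f z) (x - w)
    - 2^-1 * (L^-1 * norm2 (grad f x - grad f z) ^+ 2)
    - 2^-1 * (L^-1 * norm2 (grad f z - grad f w) ^+ 2).
Proof.
move=> L0 cf sf; have := convex_smooth_lower x z L0 cf sf.
have := convex_smooth_lower z w L0 cf sf.
move: (f x) (f z) (f w) (grad f x) (grad f z) (grad f w) => fx fz fw gx gz gw.
rewrite (norm2_sqr (gx - gz)) (norm2_sqr (gz - gw)) invfM.
rewrite (dotBC gw) (dotBC gz gx).
move: (dot (gx - gz) (gx - gz)) (dot (gz - gw) (gz - gw)) L^-1 => q1 q2 l.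
rewrite dotBl !dotBr.
move: (dot gx x) (dot gx z) (dot gz x) (dot gz z) (dot gz w) => *; lra.
Qed.

End ConvexSmooth.

(** * The dual and primal steps *)

Section Conjugate.
Context {R : realType} {d : nat}.
Implicit Types (f : 'cV[R]_d -> R) (x y : 'cV[R]_d).

Lemma fenchel_young f x y : ((dot y x - f x)%:E <= Defs.conjugate f y)%E.
Proof. by apply: ereal_sup_ubound; exists x. Qed.

Lemma conjugate_grad f x : convex_function [set: 'cV[R]_d] f ->
  differentiable (f : 'cV[R]_d -> R^o) x ->
  Defs.conjugate f (grad f x) = (dot (grad f x) x - f x)%:E.
Proof.
move=> cf df; apply/le_anti; rewrite fenchel_young andbT.
apply: ge_ereal_sup => _ [z _ <-]; rewrite lee_fin.
by have := convex_grad_le z cf df; rewrite dotBr; lra.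
Qed.

(** Equality in the Fenchel-Young inequality makes [y] a subgradient at [x]. *)
Lemma conjugate_le_grad f x y : differentiable (f : 'cV[R]_d -> R^o) x ->
  (Defs.conjugate f y <= (dot y x - f x)%:E)%E -> y = grad f x.
Proof.
move=> df h; apply: grad_subgradient_unique => // z.
have := le_trans (fenchel_young f z y) h.
by rewrite lee_fin dotBr; lra.
Qed.

End Conjugate.

Section Steps.
Context {R : realType} {d : nat}.

Lemma stackI_tr_mul b (y : 'cV[R]_(\sum_(j < b) d)) :
  (stackI R b d)^T *m y = \sum_(j < b) submxcol y j.
Proof.
rewrite /stackI tr_mxcol -{1}[y]submxcolK mul_mxrow_mxcol.
by apply: eq_bigr => j _; rewrite trmx1 mul1mx.
Qed.

(** The objective separates over the blocks. By the Fenchel-Young inequality it is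
    at most the sum of the [F j x], a value attained at the stacked gradients;
    hence a maximizer attains it, which forces equality in every block. *)
Lemma argmax_conjugate b (F : 'I_b -> 'cV[R]_d -> R) (x : 'cV[R]_d) (j : 'I_b) :
  (forall j, convex_function [set: 'cV[R]_d] (F j)) ->
  (forall j, differentiable (F j : 'cV[R]_d -> R^o) x) ->
  submxcol (argmax (fun y : 'cV[R]_(\sum_(j < b) d) =>
    ((dot ((stackI R b d)^T *m y) x)%:E
     - \sum_(j < b) Defs.conjugate (F j) (submxcol y j))%E)) j = grad (F j) x.
Proof.
move=> cF dF; set Phi := (X in argmax X).
pose S : R := \sum_(j < b) F j x.
pose y0 : 'cV[R]_(\sum_(j < b) d) := \mxcol_(j < b) grad (F j) x.
have pairE (y : 'cV[R]_(\sum_(j < b) d)) :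
    dot ((stackI R b d)^T *m y) x = \sum_(j < b) (dot (submxcol y j) x - F j x) + S.
  by rewrite stackI_tr_mul dot_suml -big_split; apply: eq_bigr => k _ /=; rewrite subrK.
have PhiS y : (Phi y <= S%:E)%E.
  rewrite /Phi pairE.
  rewrite [leRHS](_ : _ = (\sum_(j < b) (dot (submxcol y j) x - F j x) + S)%:E
      - (\sum_(j < b) (dot (submxcol y j) x - F j x))%:E)%E; last first.
    by rewrite -EFinB addrAC subrr add0r.
  apply: leeB => //; rewrite -sumEFin.
  by apply: lee_sum => k _; exact: fenchel_young.
have Phi0 : Phi y0 = S%:E.
  rewrite /Phi pairE (eq_bigr (fun j => (dot (submxcol y0 j) x - F j x)%:E)).
    by rewrite sumEFin -EFinB addrAC subrr add0r.
  by move=> k _; rewrite /y0 mxcolK conjugate_grad.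
have /(_ y0) : [set y | forall z, (Phi z <= Phi y)%O] (argmax Phi).
  by apply: getPex; exists y0 => z; rewrite Phi0.
rewrite Phi0; set y := argmax Phi => le_y.
apply: conjugate_le_grad => //.
(* Fenchel-Young holds with equality for the sum over j, hence for each j. *)
set c := dot (submxcol y j) x - F j x; set z := Defs.conjugate _ _.
pose r := \sum_(k < b | k != j) (dot (submxcol y k) x - F k x).
have conj_ge : (z + r%:E <= \sum_(k < b) Defs.conjugate (F k) (submxcol y k))%E.
  rewrite (bigD1 j) //= leeD2l // -sumEFin.
  by apply: lee_sum => k _; exact: fenchel_young.
have : (S%:E <= (c + r + S)%:E - (z + r%:E))%E.
  apply: le_trans le_y _; rewrite /Phi pairE (bigD1 j) //=.
  exact: leeB.
(* A conjugate may take the value +oo, but then the objective is -oo. *)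
clearbody z; case: z {conj_ge} => [z||].
- by rewrite !lee_fin; lra.
- by rewrite addye ?addeNy // leeNy_eq.
- by rewrite leNye.
Qed.

(** Completing the square shows that the minimizer is unique. *)
Lemma primal_stepE b (eta : R) (y : 'cV[R]_(\sum_(j < b) d)) (x : 'cV[R]_d) :
  (0 < b)%N -> 0 < eta ->
  primal_step eta y x = x - (eta / b%:R) *: \sum_(j < b) submxcol y j.
Proof.
move=> b0 eta0; rewrite /primal_step stackI_tr_mul; set g := \sum_(j < b) _.
have bR : 0 < b%:R :> R by rewrite ltr0n.
set Psi := (X in argmin X); set z0 := x - _.
have PsiE z : Psi z = Psi z0 + b%:R / (2 * eta) * dot (z - z0) (z - z0).
  rewrite /Psi !norm2_sqr /z0.
  rewrite !(dotDl, dotDr, dotNl, dotNr, dotZl, dotZr) !(dotC _ g) !(dotC x z).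
  by field; rewrite !gt_eqF.
have c0 : 0 < b%:R / (2 * eta) by rewrite divr_gt0 // mulr_gt0.
have /(_ z0) : [set z | forall w, (Psi z <= Psi w)%O] (argmin Psi).
  apply: getPex; exists z0 => z; rewrite (PsiE z) lerDl.
  by rewrite mulr_ge0 ?dot_ge0 // ltW.
rewrite PsiE gerDl pmulr_rle0 // => h.
by apply/eqP; rewrite -subr_eq0; apply/eqP/dot_eq0/le_anti; rewrite h dot_ge0.
Qed.

End Steps.

(** * Progress of one epoch *)

Section Batches.
Context {n b m : nat} (hn : n = (b * m)%N) (b0 : (0 < b)%N).

Lemma batch_of_subproof (p : 'I_n) : (p %/ b < m)%N.
Proof. by rewrite ltn_divLR // mulnC -hn. Qed.

Definition batch_of (p : 'I_n) : 'I_m := Ordinal (batch_of_subproof p).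

Lemma sum_batches (V : nmodType) (F : 'I_n -> V) :
  \sum_(p < n) F p = \sum_(i < m) \sum_(p < n | (p %/ b == i)%N) F p.
Proof. exact: (partition_big batch_of xpredT). Qed.

Lemma sum_batch_index (V : nmodType) (F : 'I_n -> V) (i : 'I_m) :
  \sum_(j < b) F (batch_index hn i j) = \sum_(p < n | (p %/ b == i)%N) F p.
Proof.
pose h' (p : 'I_n) : 'I_b := Ordinal (ltn_pmod p b0).
rewrite (reindex_onto (batch_index hn i) h') => [|p /eqP pi]; last first.
  by apply/val_inj; rewrite /= -pi mulnC -divn_eq.
apply: eq_bigl => j; rewrite /= mulnC divnMDl // divn_small // addn0 eqxx.
by apply/esym/eqP/val_inj; rewrite /= mulnC modnMDl modn_small.
Qed.

Lemma sum_tailS (V : nmodType) (F : 'I_n -> V) i :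
  \sum_(p < n | (i <= p %/ b)%N) F p =
  \sum_(p < n | (p %/ b == i)%N) F p + \sum_(p < n | (i < p %/ b)%N) F p.
Proof.
rewrite (bigID (fun p : 'I_n => (p %/ b == i)%N)) /=.
by congr (_ + _); apply: eq_bigl => p; case: ltngtP.
Qed.

End Batches.

Section Epoch.
Context {R : realType} {n d b m : nat} (hn : n = (b * m)%N) (b0 : (0 < b)%N).

(** Positions are grouped by [p %/ b], so that sums over a batch and over the
    batches from the i-th on are sums over positions with a condition. *)
Definition sgd_path (F : 'I_n -> 'cV[R]_d -> R) (eta : R) (X : nat -> 'cV[R]_d) :=
  forall i : 'I_m, X i.+1 =
    X i - (eta / b%:R) *: \sum_(p < n | (p %/ b == i)%N) grad (F p) (X i).

Lemma epoch_path (f : 'I_n -> 'cV[R]_d -> R) (pi : 'S_n) (eta : R) x :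
  (forall i, convex_function [set: 'cV[R]_d] (f i)) ->
  (forall i x, differentiable (f i : 'cV[R]_d -> R^o) x) ->
  0 < eta ->
  exists X, [/\ X 0%N = x, X m = epoch hn f pi eta x
              & sgd_path (f \o pi) eta X].
Proof.
move=> cf df eta0.
pose step x i := primal_step eta (dual_step hn f pi i x) x.
exists (fun k => foldl step x (take k (enum 'I_m))); split.
- by rewrite take0.
- by rewrite take_oversize // size_enum_ord.
move=> i; rewrite (take_nth i) ?size_enum_ord // nth_ord_enum foldl_rcons.
rewrite {1}/step primal_stepE //; congr (_ - _ *: _).
rewrite -(sum_batch_index hn b0 (fun p => grad (f (pi p)) _)).
by apply: eq_bigr => j _; rewrite /dual_step argmax_conjugate.
Qed.

Lemma path_tail (F : 'I_n -> 'cV[R]_d -> R) (eta : R) X i :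
  sgd_path F eta X -> (i <= m)%N ->
  X m = X i - (eta / b%:R) *:
        \sum_(p < n | (i <= p %/ b)%N) grad (F p) (X (p %/ b)%N).
Proof.
move=> step le_im; rewrite -(subKn le_im).
elim: (m - i)%N (leq_subr i m) => [_|k ih km].
  rewrite subn0 big_pred0 ?scaler0 ?subr0 // => p.
  by rewrite leqNgt (batch_of_subproof hn b0).
have im : (m - k.+1 < m)%N by rewrite ltn_subrL (leq_ltn_trans _ km).
have iS : (m - k = (m - k.+1).+1)%N by rewrite subnSK.
rewrite sum_tailS scalerDr opprD addrA (ih (ltnW km)) iS (step (Ordinal im)) /=.
suff <- : \sum_(p < n | (p %/ b == m - k.+1)%N) grad (F p) (X (p %/ b)%N) =
  \sum_(p < n | (p %/ b == m - k.+1)%N) grad (F p) (X (m - k.+1)%N) by [].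
by apply: eq_bigr => p /eqP->.
Qed.

Lemma ler_sum_combination (I : finType) (g0 g1 g2 g3 g4 : I -> R) c :
  (forall p, g0 p <= g1 p + g2 p - c * g3 p - c * g4 p) ->
  \sum_p g0 p <= \sum_p g1 p + \sum_p g2 p - c * \sum_p g3 p - c * \sum_p g4 p.
Proof.
by move=> h; rewrite !mulr_sumr -big_split -!sumrB; apply: ler_sum => p _.
Qed.

(** Summing the three-point inequality over the positions gives three kinds of
    terms. The terms in [X m - xs] telescope, since the gradients add up to the
    displacement of the epoch. The cross terms pair, batch by batch, a sum of gradient
    differences with the sum of the gradients used from that batch on; with a
    suitable weight in Young's inequality, [blk] turns the first factor into exactly
    the squares that the three-point inequality subtracts, which leaves tail sums
    of gradients. Splitting these at the minimizer, [tail] and the step size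
    condition absorb the deviations, and only the tail sums of gradients at [xs]
    remain. *)
Lemma epoch_descent (F : 'I_n -> 'cV[R]_d -> R) (L : 'I_n -> R)
    (eta A1 A2 : R) (X : nat -> 'cV[R]_d) (xs : 'cV[R]_d) :
  (forall p, convex_function [set: 'cV[R]_d] (F p)) ->
  (forall p, 0 < L p) -> (forall p, smooth (L p) (F p)) ->
  (forall u : 'I_n -> 'cV[R]_d,
     \sum_(i < m) norm2 (\sum_(p < n | (p %/ b == i)%N) u p) ^+ 2
     <= A1 * \sum_(p < n) (L p)^-1 * norm2 (u p) ^+ 2) ->
  (forall u : 'I_n -> 'cV[R]_d,
     \sum_(i < m) norm2 (\sum_(p < n | (i <= p %/ b)%N) u p) ^+ 2
     <= A2 * \sum_(p < n) (L p)^-1 * norm2 (u p) ^+ 2) ->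
  0 < eta -> 0 < A1 -> 2 * eta ^+ 2 * A1 * A2 <= b%:R ^+ 2 ->
  sgd_path F eta X ->
  \sum_(p < n) (F p (X m) - F p xs) <=
    b%:R / (2 * eta) * (norm2 (X 0%N - xs) ^+ 2 - norm2 (X m - xs) ^+ 2)
    + eta ^+ 2 * A1 / b%:R ^+ 2 *
      \sum_(i < m) norm2 (\sum_(p < n | (i <= p %/ b)%N) grad (F p) xs) ^+ 2.
Proof.
move=> cF L0 sF blk tail eta0 A10 small step.
have bR : 0 < b%:R :> R by rewrite ltr0n.
have combine (l D c q1 q2 s t : R) : q2 <= l ->
    q1 <= 2^-1 * D + eta ^+ 2 * A1 / (2 * b%:R ^+ 2) * s ->
    s <= 2 * (A2 * c) + 2 * t -> 0 <= c ->
    q1 + q2 - 2^-1 * D - 2^-1 * c <= l + eta ^+ 2 * A1 / b%:R ^+ 2 * t.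
  pose k := eta ^+ 2 * A1 / (2 * b%:R ^+ 2).
  have k0 : 0 <= k by rewrite divr_ge0 ?mulr_ge0 ?sqr_ge0 // ltW.
  have kA2 : 4 * k * A2 <= 1.
    rewrite (_ : 4 * k * A2 = 2 * eta ^+ 2 * A1 * A2 / b%:R ^+ 2); last first.
      by rewrite /k; field; rewrite gt_eqF.
    by rewrite ler_pdivrMr ?exprn_gt0 // mul1r.
  have -> : eta ^+ 2 * A1 / b%:R ^+ 2 = 2 * k by rewrite /k; field; rewrite gt_eqF.
  rewrite -/k => ? ? /(ler_wpM2l k0) + /ler_wpM2r/(_ _ _ kA2); rewrite mulrDr; lra.
pose y p := grad (F p) (X (p %/ b)%N); pose v p := grad (F p) (X m).
pose w p := grad (F p) xs.
pose S i := \sum_(p < n | (i <= p %/ b)%N) y p.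
pose Q (u : 'I_n -> 'cV[R]_d) := \sum_(p < n) (L p)^-1 * norm2 (u p) ^+ 2.
have pointwise p : F p (X m) - F p xs <=
    dot (v p - y p) (X m - X (p %/ b)%N) + dot (y p) (X m - xs)
    - 2^-1 * ((L p)^-1 * norm2 (v p - y p) ^+ 2)
    - 2^-1 * ((L p)^-1 * norm2 (y p - w p) ^+ 2).
  exact: convex_smooth_three_point.
have linear : \sum_(p < n) dot (y p) (X m - xs) <=
    b%:R / (2 * eta) * (norm2 (X 0%N - xs) ^+ 2 - norm2 (X m - xs) ^+ 2).
  have := path_tail step (leq0n m).
  rewrite -dot_suml; set Y := \sum_(p < n) _ => XmE.
  have -> : Y = (b%:R / eta) *: (X 0%N - X m).
    rewrite XmE subKr scalerA mulrA -[b%:R / eta * eta]mulrA mulVf ?gt_eqF //.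
    by rewrite mulr1 divff ?gt_eqF // scale1r.
  rewrite dotZl !norm2_sqr.
  have -> : X 0%N - xs = X 0%N - X m + (X m - xs) by rewrite addrA subrK.
  move: (X 0%N - X m) (X m - xs) => a c; rewrite !(dotDl, dotDr) (dotC c a).
  have := mulr_ge0 (ltW (divr_gt0 bR (mulr_gt0 (ltr0n R 2) eta0))) (dot_ge0 a).
  rewrite -subr_ge0 => h.
  rewrite -subr_ge0; apply: le_trans h _; rewrite le_eqVlt.
  by apply/orP; left; apply/eqP; field; rewrite !gt_eqF.
have cross : \sum_(p < n) dot (v p - y p) (X m - X (p %/ b)%N) <=
    2^-1 * Q (v \- y) + eta ^+ 2 * A1 / (2 * b%:R ^+ 2) *
                        \sum_(i < m) norm2 (S i) ^+ 2.
  rewrite (sum_batches hn b0).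
  (* The Young weight for which [blk] produces the coefficient 1/2. *)
  pose a := b%:R / (eta * A1).
  have a0 : 0 < a by rewrite divr_gt0 ?mulr_gt0.
  have batch (i : 'I_m) : \sum_(p < n | (p %/ b == i)%N)
      dot (v p - y p) (X m - X (p %/ b)%N) <= eta / b%:R *
      (a / 2 * norm2 (\sum_(p < n | (p %/ b == i)%N) (v p - y p)) ^+ 2
       + norm2 (S i) ^+ 2 / (2 * a)).
    rewrite (eq_bigr (fun p => - (eta / b%:R) * dot (v p - y p) (S i))) => [|p /eqP ->].
      rewrite -big_distrr /= -dot_suml mulNr -mulrN ler_pM2l ?divr_gt0 // !norm2_sqr.
      exact: dot_young.
    rewrite (path_tail step (ltnW (ltn_ord i))) addrAC subrr add0r.
    by rewrite dotNr dotZr mulNr.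
  apply: le_trans (ler_sum _ (fun i _ => batch i)) _.
  rewrite -mulr_sumr big_split /= -mulr_sumr -mulr_suml.
  have := blk (fun p => v p - y p); rewrite -/(Q (v \- y)).
  move: (Q _) (\sum_(i < m) _) (\sum_(i < m) _) => q s2 s1 h.
  rewrite [leLHS](_ : _ = 2^-1 * (s1 / A1)
      + eta ^+ 2 * A1 / (2 * b%:R ^+ 2) * s2); last first.
    by rewrite /a; field; rewrite !gt_eqF.
  by rewrite lerD2r ler_pM2l ?invr_gt0 // ler_pdivrMr // mulrC.
have tails : \sum_(i < m) norm2 (S i) ^+ 2 <= 2 * (A2 * Q (y \- w)) +
    2 * \sum_(i < m) norm2 (\sum_(p < n | (i <= p %/ b)%N) w p) ^+ 2.
  have := tail (fun p => y p - w p).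
  rewrite -/(Q (y \- w)) -(ler_pM2l (ltr0n R 2)) => h.
  apply: le_trans (lerD h (lexx _)).
  rewrite !mulr_sumr -big_split; apply: ler_sum => i _ /=.
  rewrite (_ : S i = \sum_(p < n | (i <= p %/ b)%N) (y p - w p)
      + \sum_(p < n | (i <= p %/ b)%N) w p); last first.
    by rewrite -big_split; apply: eq_bigr => p _ /=; rewrite subrK.
  by rewrite !norm2_sqr dot_sqrD.
have Qge0 : 0 <= Q (y \- w).
  by apply: sumr_ge0 => p _; rewrite mulr_ge0 ?sqr_ge0 // invr_ge0 ltW.
apply: le_trans (ler_sum_combination pointwise) _.
exact: combine linear cross tails Qge0.
Qed.

End Epoch.

(** * Operator norms of the masked matrices *)

Section OperatorNorm.
Context {R : realType}.

Lemma cauchy_schwarz_sqr p (u v : 'cV[R]_p) :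
  dot u v ^+ 2 <= norm2 u ^+ 2 * norm2 v ^+ 2.
Proof.
rewrite -exprMn -[leLHS]real_normK ?num_real // ler_sqr ?nnegrE ?mulr_ge0 ?norm2_ge0 //.
rewrite ler_norml cauchy_schwarz lerNl -dotNl (le_trans (cauchy_schwarz _ _)) //.
by rewrite -scaleN1r norm2Z normrN1 mul1r.
Qed.

(** The Frobenius bound; it serves to make the supremum in the operator norm
    finite. *)
Lemma norm2_mulmx_le p q (A : 'M[R]_(p, q)) (v : 'cV[R]_q) :
  norm2 (A *m v) <= Num.sqrt (\sum_i norm2 (row i A)^T ^+ 2) * norm2 v.
Proof.
have F0 : 0 <= \sum_i norm2 (row i A)^T ^+ 2.
  by apply: sumr_ge0 => i _; exact: sqr_ge0.
rewrite -ler_sqr ?nnegrE ?mulr_ge0 ?norm2_ge0 ?sqrtr_ge0 // exprMn (sqr_sqrtr F0).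
rewrite [leLHS]norm2_sqr mulr_suml; apply: ler_sum => i _.
have -> : (A *m v) i 0 = dot (row i A)^T v.
  by rewrite mxE; apply: eq_bigr => j _; rewrite !mxE.
by rewrite -expr2 cauchy_schwarz_sqr.
Qed.

Lemma norm2_mulmx_opnorm p q (A : 'M[R]_(p, q)) (v : 'cV[R]_q) :
  norm2 (A *m v) <= opnorm2 A * norm2 v.
Proof.
have [v0|v0] := eqVneq (norm2 v) 0.
  by rewrite (norm2_eq0 v0) mulmx0 !norm2_0 mulr0.
have gv : 0 < norm2 v by rewrite lt_def v0 norm2_ge0.
rewrite -ler_pdivrMr // mulrC.
rewrite -[(norm2 v)^-1]ger0_norm ?invr_ge0 ?norm2_ge0 // -norm2Z scalemxAr.
apply: ub_le_sup.
  exists (Num.sqrt (\sum_i norm2 (row i A)^T ^+ 2)) => _ [w /= w1 <-].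
  by apply: le_trans (norm2_mulmx_le A w) _; rewrite ler_piMr // sqrtr_ge0.
by exists ((norm2 v)^-1 *: v) => //=; rewrite norm2Z normfV ger0_norm ?norm2_ge0 // mulVf.
Qed.

Lemma opnorm2_ge0 p q (A : 'M[R]_(p, q)) : 0 <= opnorm2 A.
Proof.
apply: ub_le_sup.
  exists (Num.sqrt (\sum_i norm2 (row i A)^T ^+ 2)) => _ [w /= w1 <-].
  by apply: le_trans (norm2_mulmx_le A w) _; rewrite ler_piMr // sqrtr_ge0.
by exists 0 => /=; rewrite ?mulmx0 norm2_0.
Qed.

Lemma dot_mulmx_opnorm p (A : 'M[R]_p) (v : 'cV[R]_p) :
  dot v (A *m v) <= opnorm2 A * norm2 v ^+ 2.
Proof.
apply: le_trans (cauchy_schwarz _ _) _.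
rewrite expr2 mulrCA ler_wpM2l ?norm2_ge0 //; exact: norm2_mulmx_opnorm.
Qed.

End OperatorNorm.

Section BlockNorms.
Context {R : realType} {n d : nat}.
Implicit Types (u : 'I_n -> 'cV[R]_d) (c : pred 'I_n).

Lemma dot_mxcol u v :
  dot (\mxcol_p u p) (\mxcol_p v p) = \sum_p dot (u p) (v p).
Proof.
rewrite dotE tr_mxcol mul_mxrow_mxcol summxE.
by apply: eq_bigr => p _; rewrite dotE.
Qed.

Lemma Lam_sqrtE (L : 'I_n -> R) (pi : 'S_n) :
  Lam_sqrt d L pi = \mxdiag_(p < n) (Num.sqrt (L (pi p)))%:M.
Proof.
apply/matrixP => s t; rewrite !mxE; case: eqP => [e|_].
  by rewrite !conform_mx_id !mxE; case: eqP; rewrite ?mulr1n // mulr0n sqrtr0.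
by rewrite !mxE sqrtr0.
Qed.

(** A 0/1 diagonal matrix that is constant on blocks keeps a subset of the
    blocks, and the transpose of the stacked identities adds up those that are kept. *)
Lemma sum_blocks_diag (e : 'rV[R]_(\sum_(p < n) d)) c u :
  (forall s, e 0 s = (c (tagnat.sig1 s))%:R) ->
  (stackI R n d)^T *m (diag_mx e *m \mxcol_p u p) = \sum_(p | c p) u p.
Proof.
move=> eE; rewrite stackI_tr_mul [RHS]big_mkcond /=; apply: eq_bigr => p _.
apply/colP => k; rewrite mul_diag_mx mxE mxE.
have -> : (\mxcol_p u p) (tagnat.Rank p k) 0 = u p k 0.
  by rewrite -[in RHS](mxcolK u p) [in RHS]mxE.
rewrite eE tagnat.Rank1K.
by case: (c p); rewrite ?mul1r // mul0r mxE.
Qed.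

(** Block entries are numbered lexicographically; blocks of constant size
    [d] start at the multiples of [d], which is what the index conditions in
    the masks refer to. *)
Lemma block_indexE (s : 'I_(\sum_(p < n) d)) :
  (s = d * tagnat.sig1 s + tagnat.sig2 s :> nat)%N.
Proof.
rewrite [LHS](tagnat.rect s); congr (_ + _)%N.
rewrite -(big_ord_widen n (fun=> d) (ltnW (ltn_ord (tagnat.sig1 s)))).
by rewrite sum_nat_const card_ord mulnC.
Qed.

Lemma leq_block_index (s : 'I_(\sum_(p < n) d)) q :
  (d * q <= s)%N = (q <= tagnat.sig1 s)%N.
Proof.
have d0 : (0 < d)%N by case: (d) (tagnat.sig2 s) => [[]|].
rewrite block_indexE mulnC -leq_divRL // mulnC divnMDl //.
by rewrite divn_small ?ltn_ord // addn0.
Qed.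

Lemma Iup_blocks b i u : (0 < b)%N ->
  (stackI R n d)^T *m (Iup R _ (b * d * i) *m \mxcol_p u p)
  = \sum_(p < n | (i <= p %/ b)%N) u p.
Proof.
move=> b0; apply: (sum_blocks_diag (c := fun p : 'I_n => (i <= p %/ b)%N)) => s.
by rewrite mxE mulnAC mulnC leq_block_index leq_divRL // mulnC.
Qed.

Lemma Ibatch_blocks b i u : (0 < b)%N ->
  (stackI R n d)^T *m (Ibatch R _ b d i *m \mxcol_p u p)
  = \sum_(p < n | (p %/ b == i)%N) u p.
Proof.
move=> b0; apply: (sum_blocks_diag (c := fun p : 'I_n => (p %/ b == i)%N)) => s.
rewrite mxE !(mulnC b) -!mulnA leq_block_index ltnNge leq_block_index -ltnNge.
by rewrite !(mulnC b) -leq_divRL // -ltn_divLR // ltnS -eqn_leq eq_sym.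
Qed.

(** Evaluate the quadratic form of the matrix at the stacked vector with blocks
    [u p / sqrt (L (pi p))]: the outer factors turn its blocks into [u p], and each
    inner product with [P i E E^T P i] is the squared norm of a masked sum. *)
Lemma opnorm_blocks m (P : 'I_m -> 'M[R]_(\sum_(p < n) d)) (c : 'I_m -> pred 'I_n)
    (L : 'I_n -> R) (pi : 'S_n) u :
  (forall i, 0 < L i) -> (forall i, (P i)^T = P i) ->
  (forall i u, (stackI R n d)^T *m (P i *m \mxcol_p u p) = \sum_(p | c i p) u p) ->
  \sum_(i < m) norm2 (\sum_(p | c i p) u p) ^+ 2 <=
  opnorm2 (Lam_sqrt d L pi *m
    (\sum_(i < m) P i *m stackI R n d *m (stackI R n d)^T *m P i) *m
    Lam_sqrt d L pi) * \sum_p (L (pi p))^-1 * norm2 (u p) ^+ 2.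
Proof.
move=> L0 symP PE; set E := stackI R n d.
pose M := \sum_(i < m) P i *m E *m E^T *m P i; rewrite -/M.
pose s p := Num.sqrt (L (pi p)).
have s0 p : s p != 0 by rewrite gt_eqF // sqrtr_gt0.
pose w : 'cV[R]_(\sum_(p < n) d) := \mxcol_p ((s p)^-1 *: u p).
have Lw : Lam_sqrt d L pi *m w = \mxcol_p u p.
  rewrite Lam_sqrtE mul_mxdiag_mxcol; apply/eq_mxcol => p.
  by rewrite mul_scalar_mx scalerA -/(s p) divff ?scale1r.
have symL : (Lam_sqrt d L pi)^T = Lam_sqrt d L pi.
  by rewrite Lam_sqrtE tr_mxdiag; apply: eq_mxdiag => p; rewrite tr_scalar_mx.
have := dot_mulmx_opnorm (Lam_sqrt d L pi *m M *m Lam_sqrt d L pi) w.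
have -> : norm2 w ^+ 2 = \sum_p (L (pi p))^-1 * norm2 (u p) ^+ 2.
  rewrite norm2_sqr dot_mxcol; apply: eq_bigr => p _.
  by rewrite dotZl dotZr mulrA -invfM -expr2 sqr_sqrtr ?ltW // norm2_sqr.
congr (_ <= _).
rewrite -!mulmxA dotC dot_mulmx symL Lw dotC /M mulmx_suml dot_sumr.
apply: eq_bigr => i _.
by rewrite -!mulmxA -PE norm2_sqr dotC dot_mulmx symP dot_mulmx.
Qed.

End BlockNorms.

Section SmoothnessConstants.
Context {R : realType} {n d b m : nat}.
Variables (L : 'I_n -> R) (pi : 'S_n).
Hypotheses (L0 : forall i, 0 < L i) (n0 : (0 < n)%N) (b0 : (0 < b)%N) (m0 : (0 < m)%N).

Lemma batch_sums_le (u : 'I_n -> 'cV[R]_d) :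
  \sum_(i < m) norm2 (\sum_(p < n | (p %/ b == i)%N) u p) ^+ 2
  <= b%:R * Ltilde_pi d b m L pi
     * \sum_p (L (pi p))^-1 * norm2 (u p) ^+ 2.
Proof.
rewrite /Ltilde_pi mulrA divff ?mul1r ?pnatr_eq0 -?lt0n //.
apply: (opnorm_blocks (P := fun i : 'I_m => Ibatch R _ b d i)) => // [i|i v].
  exact: tr_diag_mx.
exact: Ibatch_blocks.
Qed.

Lemma tail_sums_le (u : 'I_n -> 'cV[R]_d) :
  \sum_(i < m) norm2 (\sum_(p < n | (i <= p %/ b)%N) u p) ^+ 2
  <= m%:R * n%:R * Lhat_pi d b m L pi
     * \sum_p (L (pi p))^-1 * norm2 (u p) ^+ 2.
Proof.
rewrite /Lhat_pi mulrA divff ?mul1r; last first.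
  by rewrite mulf_neq0 // pnatr_eq0 -lt0n.
apply: (opnorm_blocks (P := fun i : 'I_m => Iup R _ (b * d * i))) => // [i|i v].
  exact: tr_diag_mx.
exact: Iup_blocks.
Qed.

Lemma Ltilde_pi_ge0 : 0 <= Ltilde_pi d b m L pi.
Proof. by rewrite mulr_ge0 ?invr_ge0 ?ler0n ?opnorm2_ge0. Qed.

Lemma Lhat_pi_ge0 : 0 <= Lhat_pi d b m L pi.
Proof. by rewrite mulr_ge0 ?invr_ge0 ?mulr_ge0 ?ler0n ?opnorm2_ge0. Qed.

Lemma Ltilde_pi_le : Ltilde_pi d b m L pi <= Ltilde d b m L.
Proof. exact: le_bigmax. Qed.

Lemma Lhat_pi_le : Lhat_pi d b m L pi <= Lhat d b m L.
Proof. exact: le_bigmax. Qed.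

Section Positivity.
Hypotheses (hn : n = (b * m)%N) (d0 : (0 < d)%N).

(** Any nonzero vector sitting in a single block makes a batch sum or a tail
    sum nonzero, so neither bound can hold with a zero constant. *)
Lemma Lhat_Ltilde_pi_gt0 : 0 < Lhat_pi d b m L pi /\ 0 < Ltilde_pi d b m L pi.
Proof.
pose p0 := Ordinal n0.
pose u (p : 'I_n) : 'cV[R]_d := (p == p0)%:R *: delta_mx (Ordinal d0) 0.
have sum_u (c : pred 'I_n) : c p0 ->
    norm2 (\sum_(p | c p) u p) ^+ 2 = 1.
  move=> cp0; rewrite (bigD1 p0) //= big1 => [|p /andP[_ /negbTE pp0]].
    by rewrite addr0 /u eqxx scale1r norm2_delta expr1n.
  by rewrite /u pp0 scale0r.
have ge1 (c : 'I_m -> pred 'I_n) : c (Ordinal m0) p0 ->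
    1 <= \sum_(i < m) norm2 (\sum_(p | c i p) u p) ^+ 2.
  move=> /sum_u e; rewrite (bigD1 (Ordinal m0)) //= e lerDl.
  by apply: sumr_ge0 => i _; exact: sqr_ge0.
split.
  rewrite lt_def Lhat_pi_ge0 andbT; apply/eqP => e.
  have := tail_sums_le u; rewrite e mulr0 mul0r leNgt => /negP; apply.
  exact/(lt_le_trans ltr01)/ge1.
rewrite lt_def Ltilde_pi_ge0 andbT; apply/eqP => e.
have := batch_sums_le u; rewrite e mulr0 mul0r leNgt => /negP; apply.
apply/(lt_le_trans ltr01)/(ge1 (fun i p => (p %/ b == i)%N)).
by rewrite /= div0n.
Qed.

End Positivity.
End SmoothnessConstants.

(** * Uniform permutations *)

Section UniformMean.
Context {R : realType}.

Section Basics.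
Context {T : finType}.
Implicit Types g h : T -> R.

Lemma eq_unif_mean g h : g =1 h -> unif_mean g = unif_mean h.
Proof. by move=> gh; congr (_ * _); apply: eq_bigr => t _. Qed.

Lemma unif_mean_sum (I : finType) (P : pred I) (g : I -> T -> R) :
  unif_mean (fun t => \sum_(i | P i) g i t) = \sum_(i | P i) unif_mean (g i).
Proof. by rewrite /unif_mean exchange_big -mulr_sumr. Qed.

Lemma unif_meanZ a g : unif_mean (fun t => a * g t) = a * unif_mean g.
Proof. by rewrite /unif_mean -mulr_sumr mulrCA. Qed.

Lemma unif_meanD g h : unif_mean (fun t => g t + h t) = unif_mean g + unif_mean h.
Proof. by rewrite /unif_mean big_split mulrDr. Qed.

Lemma unif_mean_cst a : (0 < #|T|)%N -> unif_mean (fun=> a : R) (T := T) = a.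
Proof.
by move=> T0; rewrite /unif_mean sumr_const -[a *+ _]mulr_natl mulKf // pnatr_eq0 -lt0n.
Qed.

Lemma ler_unif_mean g h : (forall t, g t <= h t) -> unif_mean g <= unif_mean h.
Proof. by move=> gh; rewrite ler_wpM2l ?invr_ge0 ?ler0n //; exact: ler_sum. Qed.

Lemma unif_mean_reindex (s : T -> T) g : injective s ->
  unif_mean (fun t => g (s t)) = unif_mean g.
Proof. by move=> inj_s; congr (_ * _); rewrite [RHS](reindex_inj inj_s). Qed.

End Basics.

(** A component of a uniform tuple over a group is uniform: translating the tuple
    does not change the mean, so one may average over all translations first. *)
Lemma unif_mean_tnth (gT : finGroupType) K (i : 'I_K) (g : gT -> R) :
  unif_mean (fun s : K.-tuple gT => g (tnth s i)) = unif_mean g.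
Proof.
have cT : (0 < #|{: K.-tuple gT}|)%N by rewrite card_tuple expn_gt0 -cardsT cardG_gt0.
have shift (x : gT) : unif_mean (fun s : K.-tuple gT => g (tnth s i))
    = unif_mean (fun s : K.-tuple gT => g (x * tnth s i)%g).
  rewrite -(unif_mean_reindex (s := map_tuple (mulg x))); last first.
    by move=> s t /(congr1 val)/(inj_map (mulgI x))/val_inj.
  by apply: eq_unif_mean => s; rewrite tnth_map.
rewrite -[LHS](unif_mean_cst (T := gT)) -?cardsT ?cardG_gt0 //.
rewrite (eq_unif_mean shift).
transitivity (unif_mean (fun s : K.-tuple gT =>
    unif_mean (fun x => g (x * tnth s i)%g))).
  by rewrite /unif_mean -!mulr_sumr exchange_big mulrCA.
rewrite -[RHS](unif_mean_cst (T := K.-tuple gT)) //.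
by apply: eq_unif_mean => s; rewrite unif_mean_reindex //; exact: mulIg.
Qed.

(** Both schemes are uniform means over a finite sample space on which every
    permutation in use is uniform. The marginals are what matters, since the error of
    an epoch depends on the permutation of that epoch only. *)
Lemma expect_unif_mean n sch K : exists (T : finType) (h : T -> nat -> 'S_n),
  [/\ (0 < #|T|)%N,
      forall g : _ -> R, expect sch K g = unif_mean (fun t => g (h t)) &
      forall k (g : 'S_n -> R), (1 <= k <= K)%N ->
        unif_mean (fun t => g (h t k)) = unif_mean g].
Proof.
have S0 : (0 < #|{: 'S_n}|)%N by rewrite -cardsT cardG_gt0.
case: sch; last by exists 'S_n, (fun p _ => p).
exists (K.-tuple 'S_n), (fun (s : K.-tuple 'S_n) k => nth 1%g s k.-1); split => //.
  by rewrite card_tuple expn_gt0 S0.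
move=> [|k] g // kK; rewrite -(unif_mean_tnth (Ordinal kK)).
by apply: eq_unif_mean => s; rewrite (tnth_nth 1%g).
Qed.

End UniformMean.

Section Sampling.
Context {R : realType} {n d : nat}.

(** By symmetry under transpositions, the correlation [r p q] of two sampled
    vectors is the same for all [p = q] and for all [p != q]. The diagonal value is
    the mean square, and the off-diagonal one follows from [y] having sum zero. *)
Lemma sampling_without_replacement (y : 'I_n -> 'cV[R]_d) (c : pred 'I_n) :
  (2 <= n)%N -> \sum_i y i = 0 ->
  unif_mean (fun pi : 'S_n => norm2 (\sum_(p | c p) y (pi p)) ^+ 2)
  = #|c|%:R * (n%:R - #|c|%:R) / (n%:R - 1)
    * (n%:R^-1 * \sum_i norm2 (y i) ^+ 2).
Proof.
move=> n2 y0; have S0 : (0 < #|{: 'S_n}|)%N by rewrite -cardsT cardG_gt0.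
have n0 : n%:R != 0 :> R by rewrite pnatr_eq0 -lt0n (leq_trans _ n2).
have n1 : n%:R - 1 != 0 :> R.
  by rewrite subr_eq0 pnatr_eq1 gtn_eqF.
set s2 := n%:R^-1 * _.
pose r p q := unif_mean (fun pi : 'S_n => dot (y (pi p)) (y (pi q))).
have rM (t : 'S_n) p q : r (t p) (t q) = r p q.
  rewrite [RHS]/r -(unif_mean_reindex _ (mulgI t)).
  by apply: eq_unif_mean => pi; rewrite !permM.
have diag p : r p p = s2.
  have rpp q : r q q = r p p by rewrite -(rM (tperm p q) p p) tpermL.
  apply: (mulfI n0); rewrite mulVKf // mulr_natl -[in LHS](card_ord n) -sumr_const.
  rewrite (eq_bigr (fun q => r q q)) => [|q _]; last by rewrite rpp.
  rewrite -unif_mean_sum -[RHS](unif_mean_cst _ S0).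
  apply: eq_unif_mean => pi; rewrite [RHS](reindex_inj (@perm_inj _ pi)).
  by apply: eq_bigr => q _; rewrite norm2_sqr.
have off p q : p != q -> r p q = - s2 / (n%:R - 1).
  move=> pq.
  have rpq q' : q' != p -> r p q' = r p q.
    move=> q'p; by rewrite -(rM (tperm q q') p q) tpermL tpermD // eq_sym.
  have : \sum_q' r p q' = 0.
    rewrite -unif_mean_sum -[RHS](unif_mean_cst 0 S0).
    apply: eq_unif_mean => pi.
    rewrite -dot_sumr (_ : \sum_q y (pi q) = 0) ?dot0r //.
    by rewrite -[RHS]y0 [RHS](reindex_inj (@perm_inj _ pi)).
  rewrite (bigD1 p) //= diag (eq_bigr (fun=> r p q)) // sumr_const.
  rewrite (cardC1 p) card_ord -[r p q *+ _]mulr_natl -subn1 natrB ?(ltnW n2) //.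
  move=> h; apply: (mulfI n1); rewrite [RHS]mulrCA divff // mulr1.
  by apply/eqP; rewrite -addr_eq0 addrC h.
transitivity (\sum_(p in c) \sum_(q in c) r p q).
  rewrite (eq_bigr (fun p => unif_mean (fun pi : 'S_n =>
    \sum_(q in c) dot (y (pi p)) (y (pi q))))) => [|p _]; last first.
    by rewrite unif_mean_sum.
  rewrite -unif_mean_sum; apply: eq_unif_mean => pi.
  by rewrite norm2_sqr dot_suml; apply: eq_bigr => p _; rewrite dot_sumr.
transitivity (\sum_(p in c) (s2 + (#|c|%:R - 1) * (- s2 / (n%:R - 1)))).
  apply: eq_bigr => p cp; rewrite (bigD1 p) //= diag; congr (_ + _).
  rewrite (eq_bigr (fun=> - s2 / (n%:R - 1))) => [|q /andP[_ qp]]; last first.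
    by rewrite off // eq_sym.
  apply: (addrI (- s2 / (n%:R - 1))); rewrite -(bigD1 p cp (F := fun=> _)) /=.
  by rewrite sumr_const -[LHS]mulr_natl; ring.
by rewrite sumr_const -[LHS]mulr_natl; field.
Qed.

Lemma card_tail (b m : nat) (i : nat) : (0 < b)%N -> n = (b * m)%N -> (i <= m)%N ->
  #|[pred p : 'I_n | (i <= p %/ b)%N]| = (n - b * i)%N.
Proof.
move=> b0 hn im.
have bin : (b * i <= n)%N by rewrite hn leq_mul2l im orbT.
have head : #|[predC [pred p : 'I_n | (i <= p %/ b)%N]]| = (b * i)%N.
  have := big_ord_widen n (fun=> 1%N) bin => /(_ 0%N addn).
  rewrite big_const_ord iter_addn_0 mul1n => ->.
  rewrite -sum1_card; apply: eq_bigl => p.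
  by rewrite !inE -ltnNge ltn_divLR // mulnC.
by rewrite -[in RHS](card_ord n) -[in RHS](cardC [pred p : 'I_n | (i <= p %/ b)%N])
  head addnK.
Qed.

Lemma sum_mul_complement (M : R) k :
  \sum_(i < k) (M - i%:R) * i%:R =
   M * (k%:R * (k%:R - 1)) / 2 - (k%:R - 1) * k%:R * (2 * k%:R - 1) / 6.
Proof.
elim: k => [|k ih]; first by rewrite big_ord0; field.
by rewrite big_ord_recr /= ih -natr1; field.
Qed.

Lemma mean_tails (y : 'I_n -> 'cV[R]_d) (b m : nat) :
  (2 <= n)%N -> (0 < b)%N -> n = (b * m)%N -> \sum_i y i = 0 ->
  unif_mean (fun pi : 'S_n => \sum_(i < m)
    norm2 (\sum_(p < n | (i <= p %/ b)%N) y (pi p)) ^+ 2) =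
  m%:R * (n%:R - b%:R) * (n%:R + b%:R) / (6 * (n%:R - 1))
  * (n%:R^-1 * \sum_i norm2 (y i) ^+ 2).
Proof.
move=> n2 b0 hn y0; rewrite unif_mean_sum.
have n1 : n%:R - 1 != 0 :> R.
  by rewrite subr_eq0 pnatr_eq1 gtn_eqF.
have nE : n%:R = b%:R * m%:R :> R by rewrite hn natrM.
set s2 := n%:R^-1 * _.
transitivity (\sum_(i < m) (b%:R ^+ 2 / (n%:R - 1) * s2) * ((m%:R - i%:R) * i%:R)).
  apply: eq_bigr => i _.
  rewrite (sampling_without_replacement (fun p : 'I_n => (i <= p %/ b)%N)) //.
  rewrite (card_tail b0 hn (ltnW (ltn_ord i))) natrB; last first.
    by rewrite hn leq_mul2l ltnW ?orbT.
  rewrite -/s2 natrM; clearbody s2; move: n1; rewrite nE => n1. by field.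
rewrite -mulr_sumr sum_mul_complement; clearbody s2; move: n1; rewrite nE => n1.
by field.
Qed.

End Sampling.

(** * Expected optimality gap *)

Section Objective.
Context {R : realType} {n d : nat}.
Variables (f : 'I_n -> 'cV[R]_d -> R) (L : 'I_n -> R).
Hypotheses (n0 : (0 < n)%N) (cf : forall i, convex_function [set: 'cV[R]_d] (f i))
  (L0 : forall i, 0 < L i) (sf : forall i, smooth (L i) (f i)).

(** Otherwise a step against the sum of the gradients, of length one over the sum
    of the smoothness constants, would decrease the objective. *)
Lemma sum_grad_minimizer xs : (forall x, favg f xs <= favg f x) ->
  \sum_i grad (f i) xs = 0.
Proof.
move=> min; set G := \sum_i _; apply: dot_eq0; apply/le_anti.
rewrite dot_ge0 andbT; pose S := \sum_i L i.
have S0 : 0 < S.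
  rewrite /S (bigD1 (Ordinal n0)) //= ltr_pwDl // sumr_ge0 // => i _.
  exact: ltW.
pose x := xs - S^-1 *: G.
have : \sum_i f i xs <= \sum_i f i x.
  by have := min x; rewrite ler_pM2l // invr_gt0 ltr0n.
have up i : f i x <= f i xs - S^-1 * dot (grad (f i) xs) G
    + L i * (2^-1 * (S^-1 ^+ 2 * dot G G)).
  have := smooth_descent xs x (sf i).
  rewrite (_ : x - xs = - (S^-1 *: G)); last by rewrite /x addrC addKr.
  rewrite norm2_sqr !(dotNr, dotNl, dotZr, dotZl) opprK => h.
  by apply: le_trans h _; rewrite le_eqVlt; apply/orP; left; apply/eqP; ring.
move=> /le_trans/(_ (ler_sum _ (fun i _ => up i))).
rewrite big_split /= sumrB -mulr_suml -/S -mulr_sumr -dot_suml -/G => h.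
have Sinv : 0 < S^-1 by rewrite invr_gt0.
rewrite -(pmulr_rle0 _ Sinv).
have SS : S * (2^-1 * (S^-1 ^+ 2 * dot G G)) = 2^-1 * (S^-1 * dot G G).
  by field; rewrite gt_eqF.
by move: h; rewrite SS; lra.
Qed.

(** Jensen's inequality, from the tangents at the weighted mean: their linear
    parts cancel in the weighted sum. *)
Lemma favg_weighted_mean (eta : nat -> R) (X : nat -> 'cV[R]_d) (r : seq nat) xs :
  let H := \sum_(k <- r) eta k in H != 0 -> (forall k, k \in r -> 0 <= eta k) ->
  H * (favg f (H^-1 *: \sum_(k <- r) eta k *: X k) - favg f xs)
  <= \sum_(k <- r) eta k * (favg f (X k) - favg f xs).
Proof.
move=> H H0 eta0; set xb := H^-1 *: _.
have XH : \sum_(k <- r) eta k *: (X k - xb) = 0.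
  under eq_bigr do rewrite scalerBr.
  by rewrite sumrB -scaler_suml -/H scalerA divff // scale1r subrr.
have low i : H * f i xb <= \sum_(k <- r) eta k * f i (X k).
  have -> : H * f i xb =
      \sum_(k <- r) eta k * (f i xb + dot (grad (f i) xb) (X k - xb)).
    under [RHS]eq_bigr do rewrite mulrDr -dotZr.
    by rewrite big_split /= -mulr_suml -dot_sumr XH dot0r addr0.
  rewrite !big_seq; apply: ler_sum => k kr; rewrite ler_wpM2l ?eta0 //.
  exact: convex_grad_le (cf i) ((sf i).1 _).
under [leRHS]eq_bigr do rewrite mulrBr.
rewrite mulrBr sumrB -mulr_suml -/H lerD2r /favg mulrCA.
under [leRHS]eq_bigr do rewrite mulrCA.
rewrite -mulr_sumr ler_wpM2l ?invr_ge0 ?ler0n // mulr_sumr.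
apply: le_trans (ler_sum _ (fun i _ => low i)) _.
by rewrite exchange_big; apply: ler_sum => k _; rewrite mulr_sumr.
Qed.

End Objective.

Section StepSizeArithmetic.
Context {R : realType}.
Implicit Types b m n h t eta : R.

Lemma step_size_sqr b m n h t eta : 0 < n -> 0 < h -> 0 < t -> 0 < eta ->
  0 <= b -> n = b * m -> eta <= b / (n * Num.sqrt (2 * h * t)) ->
  2 * eta ^+ 2 * (b * t) * (m * n * h) <= b ^+ 2.
Proof.
move=> n0 h0 t0 eta0 b0 nE.
have q0 : 0 < 2 * h * t by rewrite mulr_gt0 // mulr_gt0.
rewrite ler_pdivlMr; last by rewrite mulr_gt0 ?sqrtr_gt0.
move=> small.
rewrite (_ : _ * (m * n * h) = (eta * (n * Num.sqrt (2 * h * t))) ^+ 2).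
  by rewrite ler_sqr ?nnegrE // !mulr_ge0 ?sqrtr_ge0 // ltW.
by rewrite !exprMn (sqr_sqrtr (ltW q0)) nE; ring.
Qed.

Lemma scale_epoch_bound b n t t' eta gap D T : 0 < b -> 0 < n -> 0 < eta ->
  0 <= T -> t <= t' ->
  n * gap <= b / (2 * eta) * D + eta ^+ 2 * (b * t) / b ^+ 2 * T ->
  eta * gap <= b / (2 * n) * D + eta ^+ 3 * t' / (b * n) * T.
Proof.
move=> b0 n0 eta0 T0 tt' h.
apply: (@le_trans _ _ (b / (2 * n) * D + eta ^+ 3 * t / (b * n) * T)).
  rewrite -(ler_pM2l (divr_gt0 n0 eta0)).
  rewrite [leLHS](_ : _ = n * gap); last by field; rewrite gt_eqF.
  apply: le_trans h _; rewrite le_eqVlt; apply/orP; left; apply/eqP.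
  by field; rewrite !gt_eqF.
rewrite lerD2l ler_wpM2r // ler_wpM2r ?invr_ge0 ?mulr_ge0 ?(ltW b0) ?(ltW n0) //.
by rewrite ler_wpM2l // exprn_ge0 // ltW.
Qed.

End StepSizeArithmetic.

Section ShuffledSGD.
Context {R : realType} {n d b m : nat} (hn : n = (b * m)%N).
Variables (f : 'I_n -> 'cV[R]_d -> R) (L : 'I_n -> R) (xs : 'cV[R]_d).
Hypotheses (n2 : (2 <= n)%N) (d0 : (0 < d)%N) (b0 : (0 < b)%N) (m0 : (0 < m)%N)
  (cf : forall i, convex_function [set: 'cV[R]_d] (f i))
  (L0 : forall i, 0 < L i) (sf : forall i, smooth (L i) (f i))
  (min : forall x, favg f xs <= favg f x).

Let n0 : (0 < n)%N. Proof. exact: leq_trans n2. Qed.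
Let nR : 0 < n%:R :> R. Proof. by rewrite ltr0n. Qed.
Let bR : 0 < b%:R :> R. Proof. by rewrite ltr0n. Qed.
Let nE : n%:R = b%:R * m%:R :> R. Proof. by rewrite {1}hn natrM. Qed.

(** The variance term of an epoch: what remains of the tail sums when the
    gradients are evaluated at the minimizer. *)
Definition tail_noise (pi : 'S_n) : R :=
  \sum_(i < m) norm2 (\sum_(p < n | (i <= p %/ b)%N) grad (f (pi p)) xs) ^+ 2.

Lemma tail_noise_ge0 pi : 0 <= tail_noise pi.
Proof. by apply: sumr_ge0 => i _; exact: sqr_ge0. Qed.

Definition step_condition (eta : R) :=
  forall pi : 'S_n, eta <= b%:R / (n%:R * Num.sqrt (2 * Lhat_pi d b m L pi
                                            * Ltilde_pi d b m L pi)).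

Lemma epoch_progress (eta : R) (pi : 'S_n) (x : 'cV[R]_d) :
  0 < eta -> step_condition eta ->
  eta * (favg f (epoch hn f pi eta x) - favg f xs) <=
    b%:R / (2 * n%:R)
      * (norm2 (x - xs) ^+ 2 - norm2 (epoch hn f pi eta x - xs) ^+ 2)
    + eta ^+ 3 * Ltilde d b m L / (b%:R * n%:R) * tail_noise pi.
Proof.
move=> eta0 /(_ pi).
have [hpos tpos] := Lhat_Ltilde_pi_gt0 pi L0 n0 b0 m0 d0.
move=> /(step_size_sqr nR hpos tpos eta0 (ltW bR) nE) small.
have [X [X0 Xm path]] := epoch_path hn b0 pi x cf (fun i => (sf i).1) eta0.
have := epoch_descent hn b0 xs (fun p => cf (pi p)) (fun p => L0 (pi p))
  (fun p => sf (pi p)) (batch_sums_le pi L0 b0) (tail_sums_le pi L0 n0 b0 m0)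
  eta0 (mulr_gt0 bR tpos) small path.
have favgE z : \sum_(p < n) f (pi p) z = n%:R * favg f z.
  by rewrite /favg mulVKf ?gt_eqF // [RHS](reindex_inj (@perm_inj _ pi)).
rewrite X0 Xm sumrB !favgE -mulrBr.
exact: (scale_epoch_bound bR nR eta0 (tail_noise_ge0 pi) (Ltilde_pi_le L pi)).
Qed.

Lemma mean_tail_noise :
  unif_mean tail_noise =
  m%:R * (n%:R - b%:R) * (n%:R + b%:R) / (6 * (n%:R - 1)) * sigma2 f xs.
Proof.
have g0 := sum_grad_minimizer n0 L0 sf min.
exact: (mean_tails (y := fun i => grad (f i) xs) n2 b0 hn g0).
Qed.

(** The inequality of each epoch holds for every realization; the distances
    telescope, and the expectation is only taken of the variance terms, each of which
    involves one permutation. *)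
Lemma expected_gap sch (x0 : 'cV[R]_d) (K : nat) (eta : nat -> R) : (1 <= K)%N ->
  (forall k, (1 <= k <= K)%N -> 0 < eta k) ->
  (forall k, (1 <= k <= K)%N -> step_condition (eta k)) ->
  expect sch K (fun pi => (\sum_(1 <= k < K.+1) eta k)
                     * (favg f (output hn f eta x0 K pi) - favg f xs))
     <= b%:R / (2 * n%:R) * norm2 (x0 - xs) ^+ 2
        + \sum_(1 <= k < K.+1)
            eta k ^+ 3 * Ltilde d b m L * (n%:R - b%:R) * (n%:R + b%:R)
              / (6 * b%:R ^+ 2 * (n%:R - 1)) * sigma2 f xs.
Proof.
move=> K1 eta0 small; set H := \sum_(1 <= k < K.+1) _.
have H0 : 0 < H.
  rewrite /H big_ltn // ltr_pwDl ?eta0 //.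
  rewrite big_nat sumr_ge0 // => k /andP[k1 kK].
  by apply/ltW/eta0; rewrite (ltnW k1) -ltnS.
pose noise k := eta k ^+ 3 * Ltilde d b m L / (b%:R * n%:R).
have pathwise pi : H * (favg f (output hn f eta x0 K pi) - favg f xs) <=
    b%:R / (2 * n%:R) * norm2 (x0 - xs) ^+ 2
    + \sum_(1 <= k < K.+1) noise k * tail_noise (pi k).
  have eta_ge0 k : k \in index_iota 1 K.+1 -> 0 <= eta k.
    by rewrite mem_index_iota => /eta0/ltW.
  have Hn0 : H != 0 by rewrite gt_eqF.
  have jensen := favg_weighted_mean cf sf (iterate hn f eta pi x0) xs Hn0 eta_ge0.
  apply: le_trans jensen _.
  pose D k := norm2 (iterate hn f eta pi x0 k - xs) ^+ 2.
  have epochs : \sum_(1 <= k < K.+1)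
      eta k * (favg f (iterate hn f eta pi x0 k) - favg f xs)
      <= \sum_(1 <= k < K.+1) (b%:R / (2 * n%:R) * (D k.-1 - D k)
                              + noise k * tail_noise (pi k)).
    rewrite big_nat [leRHS]big_nat; apply: ler_sum => -[|k] // kK.
    by apply: epoch_progress; [exact: eta0|exact: small].
  apply: le_trans epochs _; rewrite big_split /= lerD2r -mulr_sumr.
  rewrite ler_wpM2l ?divr_ge0 ?mulr_ge0 ?(ltW bR) ?(ltW nR) //.
  rewrite big_add1 /= (telescope_sumr_eq (fun k => - D k)) //; last first.
    by move=> k _; rewrite opprK addrC.
  by rewrite opprK addrC gerDl oppr_le0 sqr_ge0.
have [T [h [T0 expE marginal]]] := @expect_unif_mean R n sch K.
rewrite expE; apply: le_trans (ler_unif_mean (fun t => pathwise (h t))) _.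
rewrite unif_meanD unif_mean_cst // lerD2l big_nat.
rewrite (eq_unif_mean
  (h := fun t => \sum_(k < K) noise k.+1 * tail_noise (h t k.+1))); last first.
  by move=> t; rewrite big_add1 big_mkord.
rewrite unif_mean_sum -big_nat big_add1 big_mkord; apply: ler_sum => k _ /=.
rewrite unif_meanZ (marginal _ tail_noise) ?ltn_ord // mean_tail_noise /noise.
rewrite le_eqVlt; apply/orP; left; apply/eqP.
have mR : m%:R != 0 :> R by rewrite pnatr_eq0 -lt0n.
have n1 : n%:R - 1 != 0 :> R by rewrite subr_eq0 pnatr_eq1 gtn_eqF.
rewrite {1}nE; move: n1 (Ltilde _ _ _ _) (sigma2 _ _); rewrite nE => n1 t s2.
by field; rewrite n1 mR gt_eqF.
Qed.

End ShuffledSGD.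

(** * Query complexity *)

Section StepSizeTuning.
Context {R : realType}.

(** The step size is [b tau] with [2 (A + B) tau = 1], where [B ^+ 2 = q n t s / eps].
    The part [A] ensures the step size condition, the part [B] makes the variance
    term at most [eps / 24], and the budget makes the distance term
    at most [eps / 2]. Since [tau] does not involve [D], the case [D = 0] is not special. *)
Lemma tuned_step_size (b n K A D q t s eps : R) :
  0 < b -> 0 < n -> 0 < K -> 0 < A -> 0 <= q -> 0 <= t -> 0 <= s -> 0 < eps ->
  2 * (A * D / eps + Num.sqrt q * (Num.sqrt (n * t) * Num.sqrt s * D
                                   / (eps * Num.sqrt eps))) <= n * K ->
  exists eta, [/\ 0 < eta, 2 * A * eta <= b &
    b / (2 * n * (K * eta)) * D + eta ^+ 2 * (q * (n * t) * s) / (6 * b ^+ 2)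
    <= eps].
Proof.
move=> b0 n0 K0 A0 q0 t0 s0 eps0 budget.
have se0 : 0 < Num.sqrt eps by rewrite sqrtr_gt0.
pose N := Num.sqrt q * (Num.sqrt (n * t) * Num.sqrt s); pose B := N / Num.sqrt eps.
have B0 : 0 <= B by rewrite divr_ge0 ?mulr_ge0 ?sqrtr_ge0.
have B2 : B ^+ 2 = q * (n * t) * s / eps.
  rewrite /B /N !exprMn exprVn (sqr_sqrtr q0) (sqr_sqrtr s0) (sqr_sqrtr (ltW eps0)).
  by rewrite (sqr_sqrtr (mulr_ge0 (ltW n0) t0)) !mulrA.
have AB0 : 0 < A + B by rewrite ltr_pwDl.
pose tau := (2 * (A + B))^-1.
have two_AB0 : 0 < 2 * (A + B) by rewrite mulr_gt0.
have tau0 : 0 < tau by rewrite invr_gt0.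
have tauA : 2 * A * tau <= 1.
  by rewrite ler_pdivrMr // mul1r ler_pM2l // lerDl.
have tauB : 2 * B * tau <= 1.
  by rewrite ler_pdivrMr // mul1r ler_pM2l // lerDr ltW.
exists (b * tau); split; first by rewrite mulr_gt0.
  by rewrite mulrCA ler_piMr // ltW.
have first_term : b / (2 * n * (K * (b * tau))) * D <= eps / 2.
  rewrite [leLHS](_ : _ = D * (A + B) / (n * K)); last first.
    by rewrite /tau; field; rewrite !gt_eqF.
  rewrite ler_pdivrMr ?mulr_gt0 // -ler_pdivrMl ?divr_gt0 //.
  apply: le_trans budget; rewrite le_eqVlt; apply/orP; left; apply/eqP.
  rewrite /B /N; move: (Num.sqrt q) (Num.sqrt _) (Num.sqrt s) (Num.sqrt eps) se0.
  by move=> u v w r r0; field; rewrite !gt_eqF.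
have second_term : (b * tau) ^+ 2 * (q * (n * t) * s) / (6 * b ^+ 2) <= eps / 2.
  have -> : q * (n * t) * s = eps * B ^+ 2 by rewrite B2; field; rewrite gt_eqF.
  rewrite [leLHS](_ : _ = eps / 24 * (2 * B * tau) ^+ 2); last first.
    by field; rewrite gt_eqF.
  have sq1 : (2 * B * tau) ^+ 2 <= 1.
    by rewrite expr_le1 // !mulr_ge0 // ltW.
  apply: le_trans (ler_wpM2l _ sq1) _; first by rewrite divr_ge0 // ltW.
  lra.
by move: first_term second_term; lra.
Qed.

End StepSizeTuning.

Section Complexity.
Context {R : realType} {n d b m : nat} (hn : n = (b * m)%N).
Variables (f : 'I_n -> 'cV[R]_d -> R) (L : 'I_n -> R) (xs x0 : 'cV[R]_d).
Hypotheses (n2 : (2 <= n)%N) (d0 : (0 < d)%N) (b0 : (0 < b)%N) (m0 : (0 < m)%N)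
  (cf : forall i, convex_function [set: 'cV[R]_d] (f i))
  (L0 : forall i, 0 < L i) (sf : forall i, smooth (L i) (f i))
  (min : forall x, favg f xs <= favg f x).

Let nR : 0 < n%:R :> R. Proof. by rewrite ltr0n (leq_trans _ n2). Qed.
Let bR : 0 < b%:R :> R. Proof. by rewrite ltr0n. Qed.

Lemma constant_step_gap sch (K : nat) (eta : R) : (1 <= K)%N -> 0 < eta ->
  step_condition (d := d) (b := b) (m := m) L eta ->
  expect sch K (fun pi => favg f (output hn f (fun=> eta) x0 K pi) - favg f xs)
  <= b%:R / (2 * n%:R * (K%:R * eta)) * norm2 (x0 - xs) ^+ 2
     + eta ^+ 2 * Ltilde d b m L * (n%:R - b%:R) * (n%:R + b%:R)
       / (6 * b%:R ^+ 2 * (n%:R - 1)) * sigma2 f xs.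
Proof.
move=> K1 eta0 small.
have := expected_gap hn n2 d0 b0 m0 cf L0 sf min sch x0 K1
  (fun k _ => eta0) (fun k _ => small).
have [T [h [T0 expE _]]] := @expect_unif_mean R n sch K.
have KR : 0 < K%:R :> R by rewrite ltr0n.
have H0 : 0 < K%:R * eta by rewrite mulr_gt0.
rewrite !sumr_const_nat subSS subn0 !expE.
rewrite unif_meanZ -[eta *+ K]mulr_natl -[X in _ + X]mulr_natl.
move: (unif_mean _) (Ltilde _ _ _ _) (sigma2 _ _) => gap t s2.
move: (n%:R - b%:R) (n%:R + b%:R) (n%:R - 1) => n_b nb n_1 h1.
rewrite -(ler_pM2l H0); apply: le_trans h1 _; rewrite le_eqVlt; apply/orP; left.
apply/eqP.
have e0 : eta != 0 by rewrite gt_eqF.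
have kr0 : K%:R != 0 :> R by rewrite gt_eqF.
have nr0 : n%:R != 0 :> R by rewrite gt_eqF.
rewrite mulrDr; congr (_ + _); first by field; rewrite e0 kr0 nr0.
by rewrite expr2 exprSr expr2; ring.
Qed.

(** A factor 2 instead of [sqrt 2] leaves a slack that the constant 2 of the
    budget affords. *)
Lemma step_condition_max (eta : R) : 0 < eta ->
  2 * (n%:R * Num.sqrt (Lhat d b m L * Ltilde d b m L)) * eta <= b%:R ->
  step_condition (d := d) (b := b) (m := m) L eta.
Proof.
move=> eta0 small pi.
have [hpos tpos] := Lhat_Ltilde_pi_gt0 pi L0 (leq_trans (isT : 0 < 2)%N n2) b0 m0 d0.
have hmax := Lhat_pi_le (d := d) (b := b) (m := m) L pi.
have tmax := Ltilde_pi_le (d := d) (b := b) (m := m) L pi.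
move: (Lhat_pi _ _ _ _ _) (Ltilde_pi _ _ _ _ _) hpos tpos hmax tmax small.
move: (Lhat _ _ _ _) (Ltilde _ _ _ _) => h t hp tp hp0 tp0 hmax tmax small.
have q0 : 0 < 2 * hp * tp by rewrite mulr_gt0 // mulr_gt0.
rewrite ler_pdivlMr; last by rewrite mulr_gt0 ?sqrtr_gt0.
apply: le_trans small; rewrite [leRHS]mulrC ler_pM2l // mulrCA ler_pM2l //.
have h0 : 0 <= h by rewrite (le_trans (ltW hp0)).
have t0 : 0 <= t by rewrite (le_trans (ltW tp0)).
rewrite -ler_sqr ?nnegrE ?mulr_ge0 ?sqrtr_ge0 // exprMn.
rewrite (sqr_sqrtr (ltW q0)) (sqr_sqrtr (mulr_ge0 h0 t0)).
have : hp * tp <= h * t by rewrite ler_pM // ltW.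
have : 0 <= h * t by rewrite mulr_ge0.
rewrite -mulrA expr2; move: (hp * tp) (h * t) => *; lra.
Qed.

Lemma complexity sch (eps : R) (K : nat) : 0 < eps -> (1 <= K)%N ->
  2 * (n%:R * Num.sqrt (Lhat d b m L * Ltilde d b m L)
         * norm2 (x0 - xs) ^+ 2 / eps
       + Num.sqrt ((n%:R - b%:R) * (n%:R + b%:R) / (n%:R * (n%:R - 1)))
         * (Num.sqrt (n%:R * Ltilde d b m L) * Num.sqrt (sigma2 f xs)
            * norm2 (x0 - xs) ^+ 2 / eps `^ (3 / 2)))
  <= n%:R * K%:R ->
  exists eta : R, 0 < eta /\
    expect sch K (fun pi => favg f (output hn f (fun=> eta) x0 K pi)
                            - favg f xs) <= eps.
Proof.
move=> eps0 K1.
have n1 : 0 < n%:R - 1 :> R by rewrite subr_gt0 ltr1n.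
have KR : 0 < K%:R :> R by rewrite ltr0n.
have -> : eps `^ (3 / 2) = eps * Num.sqrt eps.
  rewrite -powR12_sqrt ?(ltW eps0) // -{2}[eps]powRr1 ?(ltW eps0) //.
  rewrite -powRD; last by rewrite (gt_eqF eps0) implybT.
  by congr (_ `^ _); field.
have [hpos tpos] := Lhat_Ltilde_pi_gt0 1%g L0 (ltnW n2) b0 m0 d0.
have h0 := lt_le_trans hpos (Lhat_pi_le L 1%g).
have t0 := lt_le_trans tpos (Ltilde_pi_le L 1%g).
have A0 : 0 < n%:R * Num.sqrt (Lhat d b m L * Ltilde d b m L).
  have := mulr_gt0 h0 t0; rewrite -sqrtr_gt0; exact: mulr_gt0 nR.
have q0 : 0 <= (n%:R - b%:R) * (n%:R + b%:R) / (n%:R * (n%:R - 1)) :> R.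
  have bn : b%:R <= n%:R :> R by rewrite ler_nat hn leq_pmulr.
  apply: divr_ge0; apply: mulr_ge0.
  - by rewrite subr_ge0.
  - by rewrite addr_ge0.
  - exact: ltW.
  - exact: ltW.
have s0 : 0 <= sigma2 f xs.
  apply: mulr_ge0; first by rewrite invr_ge0.
  by apply: sumr_ge0 => i _; exact: sqr_ge0.
move=> /(tuned_step_size bR nR KR A0 q0 (ltW t0) s0 eps0) [eta [eta0 small bound]].
exists eta; split=> //.
apply: le_trans (constant_step_gap sch K1 eta0 (step_condition_max eta0 small)) _.
apply: le_trans bound; rewrite lerD2l le_eqVlt; apply/orP; left; apply/eqP.
move: (Ltilde _ _ _ _) (sigma2 _ _) => t s2.
have nr0 : n%:R != 0 :> R by rewrite gt_eqF.
have br0 : b%:R != 0 :> R by rewrite gt_eqF.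
have n10 : n%:R - 1 != 0 :> R by rewrite gt_eqF.
by field; rewrite nr0 br0 n10.
Qed.

End Complexity.

Theorem theorem4 (R : realType) :
  exists C : R, 0 < C /\
  forall (n d b m : nat) (hn : n = (b * m)%N),
  (2 <= n)%N -> (1 <= d)%N -> (1 <= b)%N -> (1 <= m)%N ->
  forall (f : 'I_n -> 'cV[R]_d -> R) (L : 'I_n -> R) (xs x0 : 'cV[R]_d)
    (sch : scheme),
  (forall i, convex_function [set: 'cV[R]_d] (f i)) ->
  (forall i, 0 < L i) ->
  (forall i, smooth (L i) (f i)) ->
  (forall x, favg f xs <= favg f x) ->
  (forall (K : nat) (eta : nat -> R), (1 <= K)%N ->
     (forall k, (1 <= k <= K)%N -> 0 < eta k) ->
     (forall k, (1 <= k <= K)%N -> forall pi : 'S_n,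
        eta k <= b%:R / (n%:R * Num.sqrt (2 * Lhat_pi d b m L pi
                                            * Ltilde_pi d b m L pi))) ->
     expect sch K (fun pi => (\sum_(1 <= k < K.+1) eta k)
                     * (favg f (output hn f eta x0 K pi) - favg f xs))
     <= b%:R / (2 * n%:R) * norm2 (x0 - xs) ^+ 2
        + \sum_(1 <= k < K.+1)
            eta k ^+ 3 * Ltilde d b m L * (n%:R - b%:R) * (n%:R + b%:R)
              / (6 * b%:R ^+ 2 * (n%:R - 1)) * sigma2 f xs)
  /\
  (forall (eps : R) (K : nat), 0 < eps -> (1 <= K)%N ->
     C * (n%:R * Num.sqrt (Lhat d b m L * Ltilde d b m L)
            * norm2 (x0 - xs) ^+ 2 / eps
          + Num.sqrt ((n%:R - b%:R) * (n%:R + b%:R) / (n%:R * (n%:R - 1)))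
            * (Num.sqrt (n%:R * Ltilde d b m L) * Num.sqrt (sigma2 f xs)
               * norm2 (x0 - xs) ^+ 2 / eps `^ (3 / 2)))
     <= n%:R * K%:R ->
     exists eta : R, 0 < eta /\
       expect sch K (fun pi => favg f (output hn f (fun=> eta) x0 K pi)
                               - favg f xs) <= eps).
Proof.
exists 2; split=> // n d b m hn n2 d0 b0 m0 f L xs x0 sch cf L0 sf min.
split=> [K eta K1 eta0 small | eps K eps0 K1 budget].
  exact: (expected_gap hn n2 d0 b0 m0 cf L0 sf min).
exact: (complexity hn n2 d0 b0 m0 cf L0 sf min).
Qed.
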